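(* Let $A\in\mathbb{R}^{n\times n}$ and $C\in\mathbb{R}^{m\times n}$, and let $Q=C^{\mathrm T}C$. Suppose $A$ is Hurwitz and its symmetric part $A_s=\frac{A^{\mathrm T}+A}{2}$ is also Hurwitz. Consider the system $\dot x=Ax+\xi$, $y=Cx$, $x(0)=0$, where $\xi$ is a white stochastic process with zero mean and covariance $\mathbf{E}[\xi(t)\xi(\tau)^{\mathrm T}]=I_{n\times n}\,\delta(t-\tau)$, and let $\rho_{ss}(A;Q)=\lim_{t\to\infty}\mathbf{E}[x^{\mathrm T}(t)Qx(t)]$. Then $$-\sum_{i=1}^{n}\frac{\lambda_{\min}(Q)}{2\,\mathrm{Re}\{\lambda_i(A)\}}\;\le\;\rho_{ss}(A;Q)\;\le\;-\sum_{i=1}^{n}\frac{\lambda_i(Q)}{2\lambda_i(A_s)}.$$ Moreover, the lower bound is achieved (i.e. the first inequality is an equality) if and only if $A$ is normal, i.e. $A^{\mathrm T}A=AA^{\mathrm T}$, and $Q$ has $n$ identical eigenvalues.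
   Context: A real square matrix is Hurwitz if all its eigenvalues have strictly negative real parts. The eigenvalues of a symmetric matrix $M\in\mathbb{R}^{n\times n}$ are indexed in ascending order $\lambda_1(M)\le\cdots\le\lambda_n(M)$, and $\lambda_{\min}(M)$ is the smallest one; this convention applies to both $Q$ and $A_s$. For a general $A$, $\lambda_1(A),\dots,\lambda_n(A)\in\mathbb{C}$ are its eigenvalues counted with algebraic multiplicity. The performance measure $\rho_{ss}(A;Q)$ (the squared $\mathcal{H}_2$-norm from $\xi$ to $y$) equals $\mathrm{Tr}(P)$, where $P$ is the unique solution of the Lyapunov equation $PA+A^{\mathrm T}P+Q=0$; equivalently $\rho_{ss}(A;Q)=\int_0^\infty \mathrm{Tr}(e^{A^{\mathrm T}t}Qe^{At})\,dt$.
   Formalization: The equality characterization is stated for Q ≠ 0 only: if Q = 0 both bounds and ρ_ss are 0, so the lower bound is achieved for every A, including non-normal ones such as A = [[-1, 1/2],[0,-1]], and the ''only if'' fails. *)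

(* Defs.v *)
From HB Require Import structures.
From mathcomp Require Import all_boot all_order all_algebra.
From mathcomp Require Import complex.
From mathcomp Require Import all_classical all_reals all_analysis.
Set Implicit Arguments.
Unset Strict Implicit.
Unset Printing Implicit Defensive.
Import Order.TTheory GRing.Theory Num.Theory.
Import numFieldNormedType.Exports.
Local Open Scope classical_set_scope.
Local Open Scope ring_scope.
Local Open Scope complex_scope.

Section Spectra.
Context {R : realType} {n : nat}.

(* Complex eigenvalues with algebraic multiplicity: the roots of the
   characteristic polynomial, listed in an unspecified order. *)
Definition eigs (M : 'M[R]_n) : seq R[i] :=
  sval (closed_field_poly_normal (char_poly (map_mx (real_complex R) M))).

Definition eig (M : 'M[R]_n) (i : 'I_n) : R[i] := nth 0 (eigs M) i.

(* Meant for symmetric M, whose complex eigenvalues are real, so that taking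
   real parts only changes the type; the order is ascending. *)
Definition symeig (M : 'M[R]_n) (i : 'I_n) : R :=
  nth 0 (sort <=%R [seq complex.Re z | z <- eigs M]) i.

Definition hurwitz (M : 'M[R]_n) : Prop :=
  forall z : R[i], eigenvalue (map_mx (real_complex R) M) z -> complex.Re z < 0.

Definition sympart (M : 'M[R]_n) : 'M[R]_n := 2^-1 *: (M^T + M).

End Spectra.

Definition lambda_min {R : realType} {n : nat} (M : 'M[R]_n.+1) : R :=
  symeig M ord0.

Section Noise.
Context {R : realType} {n : nat} {d : measure_display} {T : measurableType d}.
Variable P : probability T R.

Definition half_line_L2 (f : R -> R) : Prop :=
  measurable_fun (`[0, +oo[%classic : set R) f /\
  (\int[lebesgue_measure]_(s in `[0%R, +oo[) ((f s) ^+ 2)%:E < +oo)%E.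

(* White noise on [0, +oo[ as a generalized process: xi i f stands for
   \int_0^oo f(t) xi_i(t) dt. The last clause is
   E[xi(t) xi(u)^T] = I delta(t - u) integrated against f(t) g(u). *)
Definition white_noise (xi : 'I_n -> (R -> R) -> T -> R) : Prop :=
  [/\ forall i f, half_line_L2 f -> xi i f \in Lfun P 2%:E,
      forall i f, half_line_L2 f -> ('E_P[xi i f] = 0)%E
    & forall i j f g, half_line_L2 f -> half_line_L2 g ->
      ('E_P[(fun w => xi i f w * xi j g w)%R] =
       ((i == j)%:R * \int[lebesgue_measure]_(s in `[0, +oo[) (f s * g s))%R%:E)%E].

(* dx/dt = A x + xi, x(0) = 0, for a jointly measurable second-order process x.
   As xi has no pointwise values, the equation is integrated over [0, t];
   the term \int_0^t xi_i is xi i \1_[0, t]. *)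
Definition lti_solution (A : 'M[R]_n) (xi : 'I_n -> (R -> R) -> T -> R)
    (x : R -> T -> 'cV[R]_n) : Prop :=
  [/\ forall i, measurable_fun ((`[0, +oo[%classic : set R) `*` [set: T])
        (fun p : R * T => x p.1 p.2 i ord0),
      forall i (t : R), 0 <= t ->
        (\int[lebesgue_measure]_(s in `[0%R, t])
           'E_P[(fun w => (x s w i ord0) ^+ 2)%R] < +oo)%E,
      {ae P, forall w, x 0 w = 0}
    & forall t : R, 0 <= t -> {ae P, forall w,
        x t w = A *m (\col_i \int[lebesgue_measure]_(s in `[0, t])
                               (x s w i ord0))
                + \col_i xi i \1_(`[0, t]) w}].

Definition mean_cost (Q : 'M[R]_n) (x : R -> T -> 'cV[R]_n) (t : R) : \bar R :=
  'E_P[(fun w => ((x t w)^T *m Q *m x t w) ord0 ord0)%R]%E.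

Definition rho_ss (Q : 'M[R]_n) (x : R -> T -> 'cV[R]_n) : \bar R :=
  lim (mean_cost Q x t @[t --> +oo]).

End Noise.

(* Main.v *)
Require Import Defs.
From HB Require Import structures.
From mathcomp Require Import all_boot all_order all_algebra.
From mathcomp Require Import complex.
From mathcomp Require Import all_classical all_reals all_analysis.
From mathcomp Require Import all_fingroup measurable_realfun.
From mathcomp Require Import lra ring.
Import Order.TTheory GRing.Theory Num.Theory.
Import numFieldNormedType.Exports.
Local Open Scope classical_set_scope.
Local Open Scope ring_scope.

(* Let X solve A X + X A^T + I = 0; it exists because A_s is negative definite,
   and it is the stationary covariance, so that rho_ss = Tr (X Q).

   To identify rho_ss without stochastic integrals, fix a row v and a time t1 and
   let phi(s) = v e^(A (t1 - s)). For a square-integrable random variable Z,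
   Fubini's theorem turns the state equation into the deterministic Volterra
   equation g = A int g + E[B Z] for g(s) = E[x(s) Z], where B(s) is the integral
   of xi over [0, s], and then (phi g)' = phi (E[B Z])'. Taking Z = B_k(s) gives
   E[v x(t1) B_k(s)], and then Z = v x(t1) gives
   E[(v x(t1))^2] = v X v^T - phi(0) X phi(0)^T, where phi(0) -> 0 as t1 -> oo.

   For the bounds, write X = U^* D U with U unitary. The diagonal entries of
   U (A X + X A^T) U^* = - I express each d_i as 1 / (-2 sum_j w_ij lambda_j(A_s))
   with w doubly stochastic. Convexity of 1/x and the rearrangement inequality for
   doubly stochastic matrices give the upper bound. For the lower bound,
   B = D^(-1/2) U A U^* D^(1/2) satisfies B + B^* = - D^-1; a Schur form of B gives
   -2 Re lambda_i(A) = sum_k w'_ik / d_k with w' doubly stochastic, whence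
   Tr X >= sum_i 1 / (-2 Re lambda_i(A)) by convexity. Strict convexity makes the
   Schur form diagonal in the case of equality, so that A is normal. *)

Set Implicit Arguments.
Unset Strict Implicit.
Unset Printing Implicit Defensive.

Local Notation toC := (map_mx (real_complex _)).
Local Notation "M ^t*" := (M ^t Num.conj)%sesqui (at level 30).

(** * Spectral theory of real matrices over R[i] *)

Lemma char_poly_conj (F : fieldType) (n : nat) (P A : 'M[F]_n) :
  P \in unitmx -> char_poly (P *m A *m invmx P) = char_poly A.
Proof.
move=> Pu; rewrite /char_poly /char_poly_mx !map_mxM.
have PV : map_mx polyC P *m map_mx polyC (invmx P) = 1%:M.
  by rewrite -map_mxM mulmxV// map_mx1.
have -> : 'X%:M - map_mx polyC P *m map_mx polyC A *m map_mx polyC (invmx P) =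
    map_mx polyC P *m ('X%:M - map_mx polyC A) *m map_mx polyC (invmx P).
  by rewrite mulmxBr mulmxBl scalar_mxC -[_%:M *m _ *m _]mulmxA PV mulmx1.
by rewrite !det_mulmx mulrAC -det_mulmx PV det1 mul1r.
Qed.

Lemma char_poly_unitary (C : numClosedFieldType) n (U M : 'M[C]_n) :
  U \is unitarymx -> char_poly (U^t* *m M *m U) = char_poly M.
Proof.
move=> Uu; have UV : invmx (U^t*) = U by rewrite invmx_unitary ?trmxC_unitary// trmxCK.
by rewrite -[X in _ *m X]UV char_poly_conj// unitarymx_unit// trmxC_unitary.
Qed.

Lemma unitarymxtP (C : numClosedFieldType) n (U : 'M[C]_n) :
  U \is unitarymx -> U^t* *m U = 1%:M.
Proof. by move=> Uu; rewrite -invmx_unitary// mulVmx// unitarymx_unit. Qed.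

Lemma unitary_conjK (C : numClosedFieldType) n (U M : 'M[C]_n) :
  U \is unitarymx -> U^t* *m (U *m M *m U^t*) *m U = M.
Proof.
move=> Uu; rewrite -(mulmxA U) mulmxA unitarymxtP// mul1mx -mulmxA unitarymxtP//.
exact: mulmx1.
Qed.

Lemma unitary_diag_comm (C : numClosedFieldType) n (U : 'M[C]_n) (s t : 'rV[C]_n) :
  U \is unitarymx ->
  (U^t* *m diag_mx s *m U) *m (U^t* *m diag_mx t *m U) =
  (U^t* *m diag_mx t *m U) *m (U^t* *m diag_mx s *m U).
Proof.
move=> Uu; rewrite !mulmxA; congr (_ *m U).
by rewrite !(mulmxtVK _ Uu) -!mulmxA diag_mxC.
Qed.

Lemma unitary_conjM (C : numClosedFieldType) n (U M N : 'M[C]_n) :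
  U \is unitarymx ->
  (U *m M *m U^t*) *m (U *m N *m U^t*) = U *m (M *m N) *m U^t*.
Proof. by move=> Uu; rewrite !mulmxA (mulmxKtV _ Uu). Qed.

Lemma unitary_conjVK (C : numClosedFieldType) n (U M D : 'M[C]_n) :
  U \is unitarymx -> M = U^t* *m D *m U -> U *m M *m U^t* = D.
Proof. by move=> Uu ->; rewrite !mulmxA (unitarymxP Uu) mul1mx mulmxtVK. Qed.

Section Spectral.
Context {R : realType}.
Implicit Types (n : nat).

(** Squared modulus, valued in [R] rather than [R[i]] so that it can serve as a real weight. *)
Definition nsq (z : R[i]) : R := complex.Re z ^+ 2 + complex.Im z ^+ 2.

Lemma nsqE (z : R[i]) : (nsq z)%:C%C = z * Num.conj z.
Proof. by rewrite /nsq add_Re2_Im2 sqr_normc. Qed.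

Lemma nsqE' (z : R[i]) : (nsq z)%:C%C = Num.conj z * z.
Proof. by rewrite nsqE mulrC. Qed.

Lemma nsq_ge0 (z : R[i]) : 0 <= nsq z.
Proof. by rewrite /nsq addr_ge0// sqr_ge0. Qed.

Lemma nsq_eq0 (z : R[i]) : nsq z = 0 -> z = 0.
Proof.
move=> h; have /eqP := nsqE z; rewrite h eq_sym mulf_eq0 conjC_eq0 orbb.
by move/eqP.
Qed.

Lemma conj_toC (x : R) : Num.conj (x%:C%C : R[i]) = x%:C%C.
Proof. exact: conjc_real. Qed.

Lemma addJ (z : R[i]) : z + Num.conj z = (2 * complex.Re z)%:C%C.
Proof. by rewrite rmorphM rmorph_nat; exact: addcJ. Qed.

Lemma toC_tr m n (M : 'M[R]_(m, n)) : (toC M)^t* = toC (M^T).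
Proof. by apply/matrixP => i j; rewrite !mxE conj_toC. Qed.

Lemma unitary_row n (U : 'M[R[i]]_n) i :
  U \is unitarymx -> \sum_j nsq (U i j) = 1.
Proof.
move=> /unitarymxP/matrixP/(_ i i); rewrite !mxE eqxx => h.
apply: complexI; rewrite rmorph_sum rmorph1 -[1]h /=.
by apply: eq_bigr => j _; rewrite nsqE !mxE.
Qed.

Lemma unitary_col n (U : 'M[R[i]]_n) j :
  U \is unitarymx -> \sum_i nsq (U i j) = 1.
Proof.
move=> Uu; rewrite -(@unitary_row _ U^T j) ?trmx_unitary//.
by apply: eq_bigr => i _; rewrite mxE.
Qed.

Lemma eigsE n (A : 'M[R]_n) :
  char_poly (toC A) = \prod_(z <- eigs A) ('X - z%:P).
Proof.
rewrite /eigs; case: closed_field_poly_normal => /= s.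
by rewrite (monicP (char_poly_monic _)) scale1r.
Qed.

(** A polynomial determines its roots with multiplicity. Only [perm_eq] can be expected, since the
    order of [eigs] is unspecified. *)
Lemma eigs_trig n (A : 'M[R]_n) (S : 'M[R[i]]_n) :
  is_trig_mx S -> char_poly (toC A) = char_poly S ->
  perm_eq (eigs A) [seq S i i | i <- enum 'I_n].
Proof.
move=> St e; apply: prod_XsubC_eq.
by rewrite -eigsE e char_poly_trig// big_map big_enum.
Qed.

Lemma size_eigs n (A : 'M[R]_n) : size (eigs A) = n.
Proof.
apply/eqP; rewrite -eqSS -(size_prod_XsubC _ id) -eigsE size_char_poly//.
Qed.

Lemma sum_eig n (A : 'M[R]_n) (F : R[i] -> R) :
  \sum_i F (eig A i) = \sum_(z <- eigs A) F z.
Proof. by rewrite (big_nth 0) size_eigs big_mkord. Qed.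

Lemma spectral_sym n (M : 'M[R]_n) : M^T = M ->
  exists2 U : 'M[R[i]]_n, U \is unitarymx &
    toC M = U^t* *m diag_mx (\row_i (symeig M i)%:C%C) *m U.
Proof.
move=> Msym.
have Mh : toC M \is hermsymmx.
  by apply/is_hermitianmxP; rewrite expr0 scale1r toC_tr Msym.
have /orthomx_spectralP := hermitian_normalmx Mh.
have := hermitian_spectral_diag_real Mh.
have := spectral_unitarymx (toC M).
set P := spectralmx _; set sp := spectral_diag _ => Pu spr ME.
have spE i : sp 0 i = (complex.Re (sp 0 i))%:C%C.
  by rewrite RRe_real//; exact: (mxOverP spr).
have pe : perm_eq (eigs M) [seq sp 0 i | i <- enum 'I_n].
  have := @eigs_trig _ M (diag_mx sp).
  rewrite (_ : [seq diag_mx sp i i | i <- enum 'I_n] = [seq sp 0 i | i <- enum 'I_n]).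
    apply; first by rewrite is_diag_mx_is_trig// diag_mx_is_diag.
    rewrite ME -{2}(invmxK P) char_poly_conj// unitmx_inv.
    exact: unitarymx_unit.
  by apply: eq_map => i; rewrite mxE eqxx mulr1n.
pose t := [tuple complex.Re (sp 0 i) | i < n].
have : perm_eq (sort <=%R [seq complex.Re z | z <- eigs M]) t.
  rewrite perm_sort; have /= := perm_map (fun z => complex.Re z) pe.
  by rewrite -map_comp.
(* The spectral decomposition lists the eigenvalues in an order of its own; the permutation [s] that
   sorts them is absorbed into the rows of the unitary matrix. *)
case/tuple_permP => s sE.
exists (row_perm s P).
  apply/unitarymxP; rewrite row_permE trmx_mul map_mxM mulmxA.
  rewrite -[X in X *m _ = _]mulmxA (unitarymxP Pu) mulmx1.
  by rewrite tr_perm_mx map_perm_mx -perm_mxM mulgV perm_mx1.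
rewrite {1}ME (invmx_unitary Pu) !mul_mx_diag.
apply/matrixP => i j; rewrite !mxE.
rewrite (reindex_inj (@perm_inj _ s)); apply: eq_bigr => k _ /=.
rewrite !mxE; congr (_ * _ * _).
rewrite /symeig sE (nth_map k) ?size_enum_ord// nth_ord_enum tnth_mktuple.
exact: spE.
Qed.

(** The weights are the squared moduli of the entries of [W *m U^t*], where [U] diagonalizes [M].
    This matrix is unitary, hence the weights are doubly stochastic. *)
Lemma diag_conj_sym n (M : 'M[R]_n) (W : 'M[R[i]]_n) : M^T = M ->
  W \is unitarymx ->
  exists w : 'I_n -> 'I_n -> R,
    [/\ forall i j, 0 <= w i j, forall i, \sum_j w i j = 1,
        forall j, \sum_i w i j = 1 &
        forall i, (W *m toC M *m W^t*) i i = (\sum_j w i j * symeig M j)%:C%C].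
Proof.
move=> Msym Wu; have [U Uu ME] := spectral_sym Msym.
pose V := W *m U^t*.
have Vu : V \is unitarymx by rewrite mul_unitarymx// trmxC_unitary.
exists (fun i j => nsq (V i j)); split.
- by move=> *; exact: nsq_ge0.
- by move=> i; exact: unitary_row.
- by move=> j; exact: unitary_col.
move=> i; rewrite ME.
have -> : W *m (U^t* *m diag_mx (\row_i0 (symeig M i0)%:C%C) *m U) *m W^t* =
   V *m diag_mx (\row_i0 (symeig M i0)%:C%C) *m V^t*.
  by rewrite /V trmx_mul map_mxM trmxCK !mulmxA.
rewrite mul_mx_diag mxE rmorph_sum; apply: eq_bigr => j _ /=.
by rewrite rmorphM/= nsqE !mxE mulrAC.
Qed.

End Spectral.

(** * Convexity and rearrangement *)

Section RealIneq.
Context {R : realType}.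

(** Jensen's inequality for 1/x. With m the mean, the gap is exactly the sum of w_k (m - a_k)^2 /
    (a_k m^2), which gives both the inequality and the equality case. *)
Lemma jensen_inv n (w a : 'I_n -> R) :
  (forall k, 0 <= w k) -> \sum_k w k = 1 -> (forall k, 0 < a k) ->
  (\sum_k w k * a k)^-1 <= \sum_k w k / a k /\
  ((\sum_k w k * a k)^-1 = \sum_k w k / a k ->
   forall k, w k != 0 -> a k = \sum_k w k * a k).
Proof.
move=> w0 w1 a0; set m := \sum_k w k * a k.
have m0 : 0 < m.
  have [k wk] : exists k, 0 < w k.
    apply/existsP; apply: contraT; rewrite negb_exists => /forallP h.
    have : \sum_k w k = 0.
      apply: big1 => k _; apply/eqP; rewrite eq_le w0 andbT leNgt; exact: h.
    by rewrite w1 => /eqP; rewrite oner_eq0.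
  rewrite /m (bigD1 k)//= ltr_pwDl ?mulr_gt0//.
  by apply: sumr_ge0 => i _; rewrite mulr_ge0// ltW.
have E : \sum_k w k / a k - m^-1 = \sum_k w k * ((m - a k) ^+ 2 / (a k * m ^+ 2)).
  have -> : \sum_k w k * ((m - a k) ^+ 2 / (a k * m ^+ 2)) =
      \sum_k (w k / a k + (m^-1 ^+ 2 * (w k * a k) - 2 * m^-1 * w k)).
    apply: eq_bigr => k _; have := lt0r_neq0 (a0 k); have := lt0r_neq0 m0.
    by move=> ? ?; field; apply/andP.
  rewrite big_split/= sumrB -!mulr_sumr w1 -/m; congr (_ + _).
  by have := lt0r_neq0 m0 => ?; field.
have t0 k : 0 <= w k * ((m - a k) ^+ 2 / (a k * m ^+ 2)).
  by rewrite mulr_ge0// divr_ge0 ?sqr_ge0// mulr_ge0 ?sqr_ge0// ltW.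
split; first by rewrite -subr_ge0 E sumr_ge0.
move=> e k wk; move: E; rewrite -e subrr => /esym/eqP.
rewrite psumr_eq0// => /allP /(_ k (mem_index_enum k)).
rewrite implyTb mulf_eq0 (negbTE wk)/= mulf_eq0 sqrf_eq0 subr_eq0 invr_eq0.
by rewrite [X in _ || X]gt_eqF ?mulr_gt0 ?exprn_gt0// orbF => /eqP.
Qed.

(** Dual potentials for the assignment problem with gain f_j q_k. The potential [u] is a discrete
    integral of q df, and the bound is an equality at j = k. The gap is a sum of products of
    increments of [f] and of differences of [q], all of the same sign. *)
Lemma rearrangement_potential (f q : nat -> R) (n : nat) :
  (forall i j, (i <= j <= n)%N -> f i <= f j) ->
  (forall i j, (i <= j <= n)%N -> q i <= q j) ->
  let u k := \sum_(0 <= l < k) (f l.+1 - f l) * q l in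
  forall j k, (j <= n)%N -> (k <= n)%N -> f j * q k <= u j + (f k * q k - u k).
Proof.
move=> fm qm u j k jn kn.
have uE a b : (a <= b)%N -> u b - u a = \sum_(a <= l < b) (f l.+1 - f l) * q l.
  by move=> ab; rewrite /u (big_cat_nat _ ab)//= addrAC subrr add0r.
have tele a b : (a <= b)%N -> \sum_(a <= l < b) (f l.+1 - f l) = f b - f a.
  by move=> ab; rewrite telescope_sumr.
rewrite -subr_ge0.
have [kj|/ltnW jk] := leqP k j.
  have -> : u j + (f k * q k - u k) - f j * q k = (u j - u k) - (f j - f k) * q k.
    by ring.
  rewrite uE// -tele// mulr_suml -sumrB big_nat_cond; apply: sumr_ge0 => l.
  rewrite andbT => /andP[kl lj]; rewrite -mulrBr mulr_ge0 ?subr_ge0//.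
    by rewrite fm// leqnSn (leq_trans lj).
  by rewrite qm// kl (leq_trans (ltnW lj)).
have -> : u j + (f k * q k - u k) - f j * q k = (f k - f j) * q k - (u k - u j).
  by ring.
rewrite uE// -tele// mulr_suml -sumrB big_nat_cond; apply: sumr_ge0 => l.
rewrite andbT => /andP[kl lj]; rewrite -mulrBr mulr_ge0 ?subr_ge0//.
  by rewrite fm// leqnSn (leq_trans lj).
by rewrite qm// (ltnW lj).
Qed.

(** Weak linear programming duality: when the potential bound is averaged with weights [D], the unit
    row and column sums leave the potentials on the diagonal, where they add up to f_i q_i. *)
Lemma doubly_stochastic_rearrangement n (D : 'I_n.+1 -> 'I_n.+1 -> R)
    (f q : 'I_n.+1 -> R) :
  (forall i j, 0 <= D i j) -> (forall i, \sum_j D i j = 1) ->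
  (forall j, \sum_i D i j = 1) ->
  (forall i j : 'I_n.+1, (i <= j)%N -> f i <= f j) ->
  (forall i j : 'I_n.+1, (i <= j)%N -> q i <= q j) ->
  \sum_i \sum_j D i j * (f i * q j) <= \sum_i f i * q i.
Proof.
move=> D0 Dr Dc fm qm.
pose f' k := f (inord k); pose q' k := q (inord k).
have mono (g : 'I_n.+1 -> R) : (forall i j : 'I_n.+1, (i <= j)%N -> g i <= g j) ->
    forall i j, (i <= j <= n)%N -> g (inord i) <= g (inord j).
  move=> gm i j /andP[ij jn]; apply: gm.
  by rewrite !inordK// ltnS (leq_trans ij).
have := @rearrangement_potential f' q' n (mono _ fm) (mono _ qm).
set u := fun k => _; rewrite /= => pot.
apply: (@le_trans _ _ (\sum_(i < n.+1) \sum_(j < n.+1)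
    (D i j * u i + D i j * (f j * q j - u j)))).
  apply: ler_sum => i _; apply: ler_sum => j _; rewrite -mulrDr ler_wpM2l//.
  by have := pot i j (ltn_ord i) (ltn_ord j); rewrite /f' /q' !inord_val.
under [X in X <= _]eq_bigr => i _ do rewrite big_split/= -mulr_suml Dr mul1r.
rewrite big_split/= [X in _ + X]exchange_big/=.
under [X in _ + X]eq_bigr => j _ do rewrite -mulr_suml Dc mul1r.
by rewrite -big_split/= le_eqVlt; apply/orP; left; apply/eqP/eq_bigr => i _; ring.
Qed.

End RealIneq.

(** * The Lyapunov equation *)

Section Lyapunov.
Context {R : realType}.

Lemma symeig_le n (M : 'M[R]_n) (i j : 'I_n) : (i <= j)%N -> symeig M i <= symeig M j.
Proof.
move=> ij; rewrite /symeig.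
have sz : size (sort <=%R [seq complex.Re z | z <- eigs M]) = n.
  by rewrite size_sort size_map size_eigs.
apply: sorted_leq_nth => //; rewrite ?inE ?sz//.
- exact: le_trans.
- exact: sort_le_sorted.
Qed.

Lemma symeig_hurwitz n (M : 'M[R]_n) : hurwitz M -> forall i, symeig M i < 0.
Proof.
move=> hM i; rewrite /symeig.
set s := [seq _ | _ <- _].
have : nth 0 (sort <=%R s) i \in s.
  by rewrite -(mem_sort <=%R) mem_nth// size_sort size_map size_eigs.
case/mapP => z zM ->; apply: hM.
by rewrite eigenvalue_root_char eigsE root_prod_XsubC.
Qed.

(** In an eigenbasis, the eigenvalue is a diagonal entry of the Gram matrix of [toC C *m U^t*], a
    sum of squared moduli. *)
Lemma symeig_gram_ge0 m n (C : 'M[R]_(m, n)) (i : 'I_n) : 0 <= symeig (C^T *m C) i.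
Proof.
set M := _ *m _; have [|U Uu ME] := @spectral_sym _ _ M.
  by rewrite /M trmx_mul trmxK.
have e : (U *m toC M *m U^t*) i i = (symeig M i)%:C%C.
  rewrite ME !mulmxA (unitarymxP Uu) mul1mx -mulmxA (unitarymxP Uu) mulmx1.
  by rewrite !mxE eqxx.
have e2 : U *m toC M *m U^t* = (toC C *m U^t*)^t* *m (toC C *m U^t*).
  by rewrite trmx_mul /M !map_mxM trmxCK toC_tr !mulmxA.
rewrite -ler0c -e e2 mxE; apply: sumr_ge0 => j _.
by rewrite !mxE -nsqE' ler0c nsq_ge0.
Qed.

(** A unitary change of basis keeps the shape of the equation. It is applied in an eigenbasis of [X]
    and, for normal [A], in an eigenbasis of [A]. *)
Lemma lyap_unitary_conj n (A X : 'M[R]_n) (U : 'M[R[i]]_n) : U \is unitarymx ->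
  A *m X + X *m A^T = - 1%:M ->
  let B := U *m toC A *m U^t* in let Y := U *m toC X *m U^t* in
  B *m Y + Y *m B^t* = - 1%:M.
Proof.
move=> Uu AX B Y.
have -> : B^t* = U *m toC A^T *m U^t*.
  by rewrite /B 2!trmx_mul 2!map_mxM trmxCK toC_tr mulmxA.
rewrite !unitary_conjM// -mulmxDl -mulmxDr -!map_mxM -map_mxD AX.
by rewrite map_mxN map_mx1 mulmxN mulmx1 mulNmx (unitarymxP Uu).
Qed.

Section Equation.
Variables (n : nat) (A X : 'M[R]_n.+1).
Hypotheses (Xsym : X^T = X) (AX : A *m X + X *m A^T = - 1%:M).
Hypothesis hAs : forall j, symeig (sympart A) j < 0.

Lemma sympart_sym : (sympart A)^T = sympart A.
Proof. by rewrite /sympart linearZ/= linearD/= trmxK addrC. Qed.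

Lemma sympartE : A + A^T = 2 *: sympart A.
Proof. by rewrite /sympart scalerA mulfV ?pnatr_eq0// scale1r addrC. Qed.

Lemma lyap_diag : exists U : 'M[R[i]]_n.+1, exists d : 'I_n.+1 -> R,
  exists w : 'I_n.+1 -> 'I_n.+1 -> R,
  [/\ U \is unitarymx, toC X = U^t* *m diag_mx (\row_i (d i)%:C%C) *m U,
    [/\ forall i j, 0 <= w i j, forall i, \sum_j w i j = 1 &
        forall j, \sum_i w i j = 1],
    forall i, 0 < d i &
    forall i, d i = (\sum_j w i j * (- 2 * symeig (sympart A) j))^-1].
Proof.
have [U Uu XE] := spectral_sym Xsym.
pose d i := symeig X i.
have [w [w0 wr wc wE]] := diag_conj_sym sympart_sym Uu.
have key i : d i * \sum_j w i j * (- 2 * symeig (sympart A) j) = 1.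
  pose A' := U *m toC A *m U^t*.
  have tA' : A'^t* = U *m toC A^T *m U^t*.
    by rewrite /A' 2!trmx_mul 2!map_mxM trmxCK toC_tr mulmxA.
  have E := lyap_unitary_conj Uu AX; rewrite /= (unitary_conjVK Uu XE) -/A' in E.
  have h2 : (A' + A'^t*) i i = (2 * \sum_j w i j * symeig (sympart A) j)%:C%C.
    rewrite tA' -mulmxDl -mulmxDr -map_mxD sympartE map_mxZ -scalemxAr -scalemxAl.
    by rewrite mxE wE -rmorphM.
  have {E} /matrixP/(_ i i) := E; move: h2; rewrite mul_mx_diag mul_diag_mx.
  clearbody A'; rewrite !mxE eqxx mulr1n [A' i i * _]mulrC -mulrDr => -> h.
  apply: complexI; rewrite rmorph1; apply: oppr_inj; rewrite -h -rmorphM -rmorphN.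
  congr (_%:C)%C; rewrite -mulrN; congr (_ * _); rewrite mulr_sumr -sumrN.
  by apply: eq_bigr => j _; ring.
(* Termwise the sum is only nonnegative; it cannot vanish because its product with [d i] is 1. *)
have pos i : 0 < \sum_j w i j * (- 2 * symeig (sympart A) j).
  have t0 j : 0 <= w i j * (- 2 * symeig (sympart A) j).
    by rewrite mulr_ge0// mulNr oppr_ge0 pmulr_rle0// ltW.
  rewrite lt_def sumr_ge0// andbT; apply/eqP => h.
  by move: (key i); rewrite h mulr0 => /esym/eqP; rewrite oner_eq0.
exists U, d, w; split => // i.
  by rewrite -(@pmulr_lgt0 _ _ _ (pos i)) key.
by rewrite -[LHS](mulfK (lt0r_neq0 (pos i))) key mul1r.
Qed.

End Equation.
End Lyapunov.

(** * Lower bound for the trace of the Lyapunov solution, with its equality case *)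

Section LowerBound.
Context {R : realType}.
Variables (n : nat) (A X : 'M[R]_n.+1).
Hypothesis AX : A *m X + X *m A^T = - 1%:M.

Lemma toC_inj m p : injective (toC : 'M[R]_(m, p) -> 'M[R[i]]_(m, p)).
Proof.
move=> M N /matrixP e; apply/matrixP => i j.
by have := e i j; rewrite !mxE => /complexI.
Qed.

Lemma normal_of_diag (P : 'M[R[i]]_n.+1) (s : 'rV[R[i]]_n.+1) :
  P \is unitarymx -> toC A = P^t* *m diag_mx s *m P -> A^T *m A = A *m A^T.
Proof.
move=> Pu AE; apply: toC_inj; rewrite !map_mxM -!toC_tr.
apply/esym/normalmxP/orthomx_spectral_subproof.
by exists (P, s) => //=; rewrite invmx_unitary.
Qed.

(** In a unitary eigenbasis of [A] with eigenvalues s_i, the diagonal of the equation reads 2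
    Re(s_i) N_ii = -1, so the trace is known exactly. This settles the attainment of the lower bound
    for normal [A]. *)
Lemma normal_trace : A^T *m A = A *m A^T ->
  - \sum_i (2 * complex.Re (eig A i))^-1 = \tr X.
Proof.
move=> Anorm.
have : toC A \is normalmx by apply/normalmxP; rewrite toC_tr -!map_mxM Anorm.
move=> /orthomx_spectralP; have := spectral_unitarymx (toC A).
set P := spectralmx _; set s := spectral_diag _ => Pu; rewrite invmx_unitary// => AE.
have pe : perm_eq (eigs A) [seq diag_mx s i i | i <- enum 'I_n.+1].
  apply: eigs_trig; first by rewrite is_diag_mx_is_trig// diag_mx_is_diag.
  by rewrite AE char_poly_unitary.
pose N := P *m toC X *m P^t*.
have E := lyap_unitary_conj Pu AX; rewrite /= (unitary_conjVK Pu AE) -/N in E.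
have trN : (\tr X)%:C%C = \tr N.
  rewrite /N -mulmxA mxtrace_mulC -mulmxA unitarymxtP// mulmx1.
  by rewrite /mxtrace rmorph_sum; apply: eq_bigr => i _; rewrite mxE.
apply: complexI; rewrite trN (sum_eig A (fun z => (2 * complex.Re z)^-1)).
rewrite (perm_big _ pe)/= big_map big_enum/=.
rewrite rmorphN rmorph_sum/= -sumrN; apply: eq_bigr => i _.
have {E}/matrixP/(_ i i) := E; clearbody N.
rewrite mul_diag_mx tr_diag_mx map_diag_mx mul_mx_diag !mxE eqxx !mulr1n.
rewrite [N i i * _]mulrC -mulrDl addJ => h.
(* The diagonal equation itself excludes a zero real part. *)
have : (2 * complex.Re (s 0 i))%:C%C != 0 :> R[i].
  by apply/eqP => e; move: h; rewrite e mul0r => /esym/eqP; rewrite oppr_eq0 oner_eq0.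
move=> nz; apply: (mulfI nz); rewrite h mulrN -rmorphM divff ?rmorph1//.
by apply: contra nz => /eqP ->; rewrite rmorph0.
Qed.

(** Rescaling by the square root of the diagonal form of [X] preserves the spectrum of [A] and turns
    the Lyapunov equation into an explicit formula for the Hermitian part. The diagonal of a Schur
    form then consists of the eigenvalues of [A], with real parts that are averages of the -1/(2
    d_k). *)
Lemma trace_lower (U : 'M[R[i]]_n.+1) (d : 'I_n.+1 -> R) :
  U \is unitarymx -> toC X = U^t* *m diag_mx (\row_i (d i)%:C%C) *m U ->
  (forall i, 0 < d i) ->
  - \sum_i (2 * complex.Re (eig A i))^-1 <= \sum_i d i /\
  (- \sum_i (2 * complex.Re (eig A i))^-1 = \sum_i d i -> A^T *m A = A *m A^T).
Proof.
move=> Uu XE d0.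
pose A' := U *m toC A *m U^t*.
have E := lyap_unitary_conj Uu AX; rewrite /= (unitary_conjVK Uu XE) -/A' in E.
have AE : toC A = U^t* *m A' *m U.
  by rewrite unitary_conjK.
have cpA' : char_poly (toC A) = char_poly A'.
  by rewrite AE char_poly_unitary.
clearbody A'.
pose s i : R[i] := (Num.sqrt (d i))%:C%C.
have s2 i : s i ^+ 2 = (d i)%:C%C by rewrite -rmorphXn/= sqr_sqrtr// ltW.
have s0 i : s i != 0 by rewrite -sqrf_eq0 s2 fmorph_eq0 gt_eqF.
have sJ i : Num.conj (s i) = s i by rewrite conj_toC.
(* Entrywise form of [invmx Ds *m A' *m Ds], where [Ds] is the diagonal matrix of the square roots
   [s i]. *)
pose B := \matrix_(i, j) (A' i j * s j / s i).
have BJ : B + B^t* = - diag_mx (\row_i ((d i)^-1)%:C%C).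
  apply/matrixP => i j; have := congr1 (fun M : 'M[R[i]]_(n.+1) => M i j) E.
  rewrite mul_mx_diag mul_diag_mx !mxE -!s2 !rmorphM !fmorphV /= !sJ => h.
  have -> : A' i j * s j / s i + Num.conj (A' j i) * s i / s j =
    (A' i j * s j ^+ 2 + s i ^+ 2 * Num.conj (A' j i)) / (s i * s j).
    by field; rewrite !s0.
  rewrite h; have [->|ij] := eqVneq i j; last by rewrite oppr0 mul0r.
  by rewrite -expr2 s2 mulNr mul1r -fmorphV.
have BE i j : B i j = A' i j * s j / s i by rewrite mxE.
clearbody B; pose Ds := diag_mx (\row_i s i).
have DsV : Ds *m diag_mx (\row_i (s i)^-1) = 1%:M.
  rewrite mul_diag_mx; apply/matrixP => i j; rewrite !mxE.
  by have [->|ij] := eqVneq i j; rewrite ?mulr0// mulfV.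
have [Dsu _] := mulmx1_unit DsV.
have DsBV : A' = Ds *m B *m invmx Ds.
  apply: (canRL (mulmxK Dsu)); rewrite mul_mx_diag mul_diag_mx.
  by apply/matrixP => i j; rewrite !mxE BE [RHS]mulrC mulfVK.
have [V Vu] := @Schur _ _ B (ltn0Sn n); rewrite /similar_to conjymx//.
set S := V *m B *m V^t* => St.
have SE : S = V *m B *m V^t* by [].
clearbody Ds S.
have BS : B = V^t* *m S *m V.
  by rewrite SE unitary_conjK.
have pe : perm_eq (eigs A) [seq S i i | i <- enum 'I_n.+1].
  apply: eigs_trig; first exact: St.
  by rewrite cpA' DsBV (char_poly_conj B Dsu) BS (char_poly_unitary S Vu).
have SJ : S + S^t* = - (V *m diag_mx (\row_i ((d i)^-1)%:C%C) *m V^t*).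
  rewrite -mulNmx -mulmxN -BJ mulmxDr mulmxDl -SE; congr (_ + _).
  by rewrite SE 2!trmx_mul 2!map_mxM trmxCK mulmxA.
pose w i k := nsq (V i k).
have w0 i k : 0 <= w i k by exact: nsq_ge0.
have SR i : - (2 * complex.Re (S i i)) = \sum_k w i k * (d k)^-1.
  apply: complexI; rewrite rmorphN /= -addJ.
  have -> : S i i + Num.conj (S i i) = (S + S^t*) i i by rewrite !mxE.
  rewrite SJ mxE opprK mul_mx_diag mxE rmorph_sum; apply: eq_bigr => k _ /=.
  by rewrite rmorphM/= nsqE !mxE mulrAC.
have J i := @jensen_inv R n.+1 (w i) (fun k => (d k)^-1) (w0 i)
  (unitary_row i Vu) (fun k => etrans (invr_gt0 _) (d0 k)).
have sumE : - \sum_i (2 * complex.Re (eig A i))^-1 =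
    \sum_i (\sum_k w i k * (d k)^-1)^-1.
  rewrite (sum_eig A (fun z => (2 * complex.Re z)^-1)) (perm_big _ pe)/=.
  by rewrite big_map big_enum -sumrN; apply: eq_bigr => i _; rewrite -SR invrN.
have sumd : \sum_i d i = \sum_i \sum_k w i k / (d k)^-1.
  rewrite exchange_big/=; apply: eq_bigr => k _.
  by rewrite -mulr_suml invrK unitary_col// mul1r.
rewrite sumE sumd; split; first by apply: ler_sum => i _; case: (J i).
move=> e.
(* The Jensen gaps are nonnegative and add up to zero, so each of them vanishes. *)
have eJ i : forall k, w i k != 0 -> (d k)^-1 = \sum_k w i k * (d k)^-1.
  case: (J i) => _; apply; apply/eqP; rewrite eq_sym -subr_eq0.
  have : \sum_i (\sum_k w i k / (d k)^-1 - (\sum_k w i k * (d k)^-1)^-1) == 0.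
    by rewrite sumrB e subrr.
  rewrite psumr_eq0; last by move=> l _; rewrite subr_ge0; case: (J l).
  by move=> /allP/(_ i (mem_index_enum i)).
pose m i := \sum_k w i k * (d k)^-1.
(* Equality in Jensen gives 1/d_k = m_i wherever V_ik is nonzero, which is the entrywise form of
   this intertwining relation. *)
have VD : V *m diag_mx (\row_i ((d i)^-1)%:C%C) = diag_mx (\row_i (m i)%:C%C) *m V.
  rewrite mul_mx_diag mul_diag_mx; apply/matrixP => i k; rewrite !mxE.
  have [h|/eJ ->] := eqVneq (w i k) 0; last by rewrite mulrC.
  by rewrite (nsq_eq0 h) mul0r mulr0.
(* By [VD] the Hermitian part of [S] is diagonal; a triangular matrix with diagonal Hermitian part
   is diagonal. *)
have Sd : S = diag_mx (\row_i S i i).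
  have offd (i j : 'I_n.+1) : (i < j)%N -> S i j = 0 /\ S j i = 0.
    move=> ij; have Sij : S i j = 0 by exact: (is_trig_mxP St).
    split => //; have := congr1 (fun M : 'M[R[i]]_(n.+1) => M j i) SJ.
    rewrite VD mulmxtVK// !mxE Sij conjC0 addr0 => ->.
    by rewrite -val_eqE gtn_eqF ?mulr0n ?oppr0.
  apply/matrixP => i j; rewrite !mxE.
  have [->|ij] := eqVneq i j; first by rewrite mulr1n.
  rewrite mulr0n; case: (ltngtP i j) => [/offd[]|/offd[]|/val_inj] //.
  by move=> h; rewrite h eqxx in ij.
(* Both factors are diagonal in the orthonormal basis given by [V]. *)
have comm : B *m diag_mx (\row_i ((d i)^-1)%:C%C) = diag_mx (\row_i ((d i)^-1)%:C%C) *m B.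
  have -> : diag_mx (\row_i ((d i)^-1)%:C%C) = V^t* *m diag_mx (\row_i (m i)%:C%C) *m V.
    by rewrite -mulmxA -VD mulmxA (unitarymxtP Vu) mul1mx.
  by rewrite BS Sd (unitary_diag_comm _ _ Vu).
(* Commutation forces d_i = d_j at every nonzero entry (i, j) of [B], and there the rescaling factor
   s_j / s_i is 1. *)
have A'B : A' = B.
  apply/matrixP => i j; rewrite BE.
  have := congr1 (fun M : 'M[R[i]]_(n.+1) => M i j) comm.
  rewrite mul_mx_diag mul_diag_mx !mxE [_ * B i j]mulrC BE => h.
  have [z|nz] := eqVneq (A' i j * s j / s i) 0.
    rewrite z; move/eqP: z; rewrite !mulf_eq0 invr_eq0 !(negbTE (s0 _)) !orbF.
    by move/eqP.
  move/(mulfI nz)/complexI/invr_inj: h => h.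
  by rewrite /s h mulfK//; exact: s0.
apply: (@normal_of_diag (V *m U) (\row_i S i i)).
  exact: mul_unitarymx.
by rewrite -Sd AE A'B BS trmx_mul map_mxM !mulmxA.
Qed.

End LowerBound.

(** * Two-sided bounds for the trace of [X *m Q] *)

Section LyapunovTrace.
Context {R : realType}.

(** In an eigenbasis of [X], the trace is a sum of d_i times means of the eigenvalues of [Q]. The
    lower bound goes through [q0 * \tr X], so equality splits into one condition on [Q] and one on
    [A]. For [Q = 0] both sides of the lower bound vanish whatever [A] is, hence the hypothesis on
    [Q] in the equality case. *)
Lemma lyap_bounds n (A Q X : 'M[R]_n.+1) :
  X^T = X -> A *m X + X *m A^T = - 1%:M ->
  (forall j, symeig (sympart A) j < 0) ->
  Q^T = Q -> (forall k, 0 <= symeig Q k) ->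
  let lower := - \sum_(i < n.+1) lambda_min Q / (2 * complex.Re (eig A i)) in
  let upper := - \sum_(i < n.+1) symeig Q i / (2 * symeig (sympart A) i) in
  lower <= \tr (X *m Q) <= upper /\
  (Q <> 0 -> (lower = \tr (X *m Q) <->
     A^T *m A = A *m A^T /\ (forall i j, symeig Q i = symeig Q j))).
Proof.
move=> Xsym AX hAs Qsym Q0 lower upper.
have [U [d [w [Uu XE [w0 wr wc] d0 dE]]]] := lyap_diag Xsym AX hAs.
have [w' [w'0 w'r w'c w'E]] := diag_conj_sym Qsym Uu.
have trXQ : \tr (X *m Q) = \sum_i d i * \sum_k w' i k * symeig Q k.
  apply: complexI; rewrite [RHS]rmorph_sum/= -[LHS]trace_map_mx map_mxM.
  rewrite XE -(mulmxA (U^t* *m _)) -(mulmxA (U^t*)) mxtrace_mulC -(mulmxA (diag_mx _)).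
  rewrite /mxtrace; apply: eq_bigr => i _.
  by rewrite mul_diag_mx mxE mxE w'E -rmorphM.
have trX : \tr X = \sum_i d i.
  apply: complexI; rewrite [RHS]rmorph_sum/= -[LHS]trace_map_mx.
  rewrite XE -mulmxA mxtrace_mulC -mulmxA (unitarymxP Uu) mulmx1 /mxtrace.
  by apply: eq_bigr => i _; rewrite !mxE eqxx.
pose q := symeig Q; pose q0 := lambda_min Q.
have q0q k : q0 <= q k by exact: symeig_le.
have [L1 L2] := trace_lower AX Uu XE d0.
have lE : lower = q0 * - \sum_i (2 * complex.Re (eig A i))^-1.
  by rewrite /lower -/q0 mulrN mulr_sumr.
have sE : q0 * \sum_i d i = \sum_i d i * \sum_k w' i k * q0.
  by rewrite mulr_sumr; apply: eq_bigr => i _; rewrite -mulr_suml w'r mul1r mulrC.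
have le1 : lower <= q0 * \sum_i d i by rewrite lE ler_wpM2l//; exact: Q0.
have le2 : q0 * \sum_i d i <= \tr (X *m Q).
  rewrite sE trXQ; apply: ler_sum => i _; rewrite ler_wpM2l ?(ltW (d0 i))//.
  by apply: ler_sum => k _; rewrite ler_wpM2l.
split.
  apply/andP; split; first exact: le_trans le2.
  (* Since the eigenvalues of A_s are negative and ascending, [f] is ascending too, in the same
     order as [q]. *)
  pose f j := (- 2 * symeig (sympart A) j)^-1.
  have a0 j : 0 < - 2 * symeig (sympart A) j by rewrite mulNr oppr_gt0 pmulr_rlt0.
  have df i : d i <= \sum_j w i j * f j.
    by rewrite dE; case: (jensen_inv (w0 i) (wr i) a0).
  have -> : upper = \sum_i f i * q i.
    rewrite /upper -sumrN; apply: eq_bigr => i _.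
    by rewrite /f mulNr invrN mulNr mulrC.
  rewrite trXQ; apply: (@le_trans _ _ (\sum_i (\sum_j w i j * f j) * \sum_k w' i k * q k)).
    apply: ler_sum => i _; rewrite ler_wpM2r// sumr_ge0// => k _.
    by rewrite mulr_ge0// Q0.
  (* The combined weights are the entries of w^T w', a product of doubly stochastic matrices. *)
  have -> : \sum_i (\sum_j w i j * f j) * \sum_k w' i k * q k =
     \sum_j \sum_k (\sum_i w i j * w' i k) * (f j * q k).
    transitivity (\sum_i \sum_j \sum_k (w i j * w' i k) * (f j * q k)).
      apply: eq_bigr => i _; rewrite mulr_suml; apply: eq_bigr => j _.
      by rewrite mulr_sumr; apply: eq_bigr => k _; ring.
    rewrite exchange_big/=; apply: eq_bigr => j _.
    by rewrite exchange_big/=; apply: eq_bigr => k _; rewrite mulr_suml.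
  apply: (@doubly_stochastic_rearrangement R n (fun j k => \sum_i w i j * w' i k)).
  - by move=> i j; apply: sumr_ge0 => k _; rewrite mulr_ge0.
  - move=> j; rewrite exchange_big/= -(wc j); apply: eq_bigr => i _.
    by rewrite -mulr_sumr w'r mulr1.
  - move=> j; rewrite exchange_big/= -(w'c j); apply: eq_bigr => i _.
    by rewrite -mulr_suml wr mul1r.
  - move=> i j ij; rewrite /f lef_pV2 ?posrE//.
    by rewrite !mulNr lerN2 ler_pM2l// symeig_le.
  - by move=> i j; exact: symeig_le.
move=> Qn0; split.
  move=> le; have e1 : lower = q0 * \sum_i d i by apply/le_anti; rewrite le1 le.
  (* The gap is a sum of nonnegative terms d_i w'_ik (q_k - q0), so w'_ik (q_k - q0) = 0 for all i
     and k. Summing over i with unit column sums yields the claim. *)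
  have qq k : q k = q0.
    have : \sum_i d i * \sum_k w' i k * (q k - q0) == 0.
      have e2 : \tr (X *m Q) - q0 * \sum_i d i = 0 by rewrite -le e1 subrr.
      apply/eqP; rewrite -[RHS]e2 trXQ sE -sumrB; apply: eq_bigr => i _.
      by rewrite -mulrBr -sumrB; congr (_ * _); apply: eq_bigr => l _; exact: mulrBr.
    rewrite psumr_eq0; last first.
      move=> i _; rewrite mulr_ge0 ?(ltW (d0 i))// sumr_ge0// => l _.
      by rewrite mulr_ge0// subr_ge0.
    move=> /allP h; apply/eqP; rewrite -subr_eq0 -[_ - _]mul1r -(w'c k) mulr_suml.
    apply/eqP/big1 => i _; have := h i (mem_index_enum i); rewrite implyTb mulf_eq0.
    rewrite gt_eqF//= psumr_eq0; last by move=> l _; rewrite mulr_ge0// subr_ge0.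
    by move=> /allP/(_ k (mem_index_enum k))/eqP.
  split; last by move=> i j; rewrite -/(q i) -/(q j) !qq.
  apply: L2; apply: (@mulfI _ q0); last by rewrite -lE.
  (* Cancelling [q0] is legitimate: if it were zero, all eigenvalues of [Q] would vanish and [Q]
     with them. *)
  apply/eqP => z; apply: Qn0; have [V Vu QE] := spectral_sym Qsym.
  apply: toC_inj; rewrite QE (_ : diag_mx _ = 0) ?mulmx0 ?mul0mx ?map_mx0//.
  by apply/matrixP => i j; rewrite !mxE -/(q i) qq z mul0rn.
move=> [Anorm qq].
rewrite lE (normal_trace AX Anorm) trX sE trXQ; apply: eq_bigr => i _.
by congr (_ * _); apply: eq_bigr => k _; rewrite (qq k ord0).
Qed.

End LyapunovTrace.

(** * Solvability of the Lyapunov equation when the symmetric part is negative definite *)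

Section NegativeDefinite.
Context {R : realType}.
Variables (n : nat) (A : 'M[R]_n.+1).
Hypothesis hAs : forall j, symeig (sympart A) j < 0.

(** The quadratic forms of [A] and of A_s agree, and that of A_s is bounded through its largest
    eigenvalue, which has index [ord_max] in the ascending order; [mu] is its opposite. *)
Lemma sympart_negdef : exists2 mu : R, 0 < mu &
  forall v : 'cV[R]_n.+1, (v^T *m A *m v) 0 0 <= - mu * (v^T *m v) 0 0.
Proof.
pose a := symeig (sympart A) ord_max; exists (- a) => [|v]; first by rewrite oppr_gt0 /a hAs.
have [U Uu ME] := spectral_sym (sympart_sym A).
rewrite opprK.
have -> : (v^T *m A *m v) 0 0 = (v^T *m sympart A *m v) 0 0.
  apply: (@mulfI _ 2); first by rewrite pnatr_eq0.
  have -> : 2 * (v^T *m sympart A *m v) 0 0 = (v^T *m (A + A^T) *m v) 0 0.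
    by rewrite sympartE -(scalemxAr 2) -(scalemxAl 2) [RHS]mxE.
  rewrite mulmxDr mulmxDl [RHS]mxE mulr_natl mulr2n; congr (_ + _).
  by rewrite -[in RHS](trmxK v) -!trmx_mul mulmxA [RHS]mxE trmxK.
pose y := U *m toC v.
have yJ : (toC v)^t* *m U^t* = y^t* by rewrite /y trmx_mul map_mxM.
have e1 : (v^T *m sympart A *m v) 0 0 = \sum_j nsq (y j 0) * symeig (sympart A) j.
  apply: complexI; rewrite rmorph_sum/=.
  have -> : ((v^T *m sympart A *m v) 0 0)%:C%C =
      (toC (v^T *m sympart A *m v)) 0 0 by rewrite [RHS]mxE.
  rewrite !map_mxM ME -toC_tr !mulmxA yJ -(mulmxA _ U) -/y mul_mx_diag mxE.
  by apply: eq_bigr => j _; rewrite rmorphM/= nsqE' !mxE mulrAC.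
have e2 : (v^T *m v) 0 0 = \sum_j nsq (y j 0).
  apply: complexI; rewrite rmorph_sum/=.
  have -> : ((v^T *m v) 0 0)%:C%C = (toC (v^T *m v)) 0 0 by rewrite [RHS]mxE.
  have -> : toC (v^T *m v) = y^t* *m y.
    by rewrite -yJ /y mulmxA mulmxKtV// map_mxM toC_tr.
  by rewrite mxE; apply: eq_bigr => j _; rewrite nsqE' !mxE.
rewrite e1 e2 mulr_sumr; apply: ler_sum => j _; rewrite mulrC ler_wpM2r ?nsq_ge0//.
by apply: symeig_le; rewrite -ltnS.
Qed.

Lemma normsq_eq0 (v : 'cV[R]_n.+1) : (v^T *m v) 0 0 <= 0 -> v = 0.
Proof.
rewrite mxE => h; apply/matrixP => i j; rewrite ord1 mxE.
have : \sum_k v k 0 ^+ 2 == 0.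
  rewrite eq_le sumr_ge0 ?andbT; last by move=> k _; rewrite sqr_ge0.
  by apply: le_trans h; apply: ler_sum => k _; rewrite mxE.
rewrite psumr_eq0; last by move=> k _; rewrite sqr_ge0.
by move=> /allP/(_ i (mem_index_enum i)); rewrite sqrf_eq0 => /eqP.
Qed.

Lemma negdef_unit : A \in unitmx.
Proof.
have [mu mu0 hmu] := sympart_negdef.
rewrite -row_free_unit -kermx_eq0; apply/eqP/row_matrixP => i; rewrite row0.
set u := row i _; have uA : u *m A = 0 by apply/sub_kermxP; exact: row_sub.
apply: trmx_inj; rewrite trmx0; apply: normsq_eq0.
by have := hmu u^T; rewrite trmxK uA mul0mx mxE mulNr oppr_ge0 pmulr_rle0.
Qed.

(** Pairing the equation with [X^T] under the trace bounds 0 above by -2 mu times the squared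
    Frobenius norm of [X]. Symmetry of [X] is not assumed, so the lemma applies to the whole matrix
    space. *)
Lemma lyap_inj (X : 'M[R]_n.+1) : A *m X + X *m A^T = 0 -> X = 0.
Proof.
move=> AX; have [mu mu0 hmu] := sympart_negdef.
have quad (Y M : 'M[R]_n.+1) j :
    ((col j Y)^T *m M *m col j Y) 0 0 = (Y^T *m M *m Y) j j.
  rewrite tr_col -row_mul [LHS]mxE [RHS]mxE; apply: eq_bigr => k _.
  by rewrite mxE [col _ _ _ _]mxE.
have nrm (Y : 'M[R]_n.+1) j : ((col j Y)^T *m col j Y) 0 0 = (Y^T *m Y) j j.
  by have := quad Y 1%:M j; rewrite !mulmx1.
have tr_le (Y : 'M[R]_n.+1) : \tr (Y^T *m A *m Y) <= - mu * \tr (Y^T *m Y).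
  rewrite /mxtrace mulr_sumr; apply: ler_sum => j _.
  by have := hmu (col j Y); rewrite quad nrm.
have t0 : \tr (X^T *m A *m X) + \tr (X *m A *m X^T) = 0.
  have -> : \tr (X *m A *m X^T) = \tr (X^T *m X *m A^T).
    rewrite -[RHS]mxtrace_tr !trmx_mul !trmxK mxtrace_mulC [RHS]mxtrace_mulC.
    by rewrite !mulmxA.
  by rewrite -!mulmxA -raddfD/= -mulmxDr AX mulmx0 mxtrace0.
have h1 := tr_le X; have h2 := tr_le X^T.
rewrite trmxK [X in _ <= _ * X]mxtrace_mulC in h2.
have nX : \tr (X^T *m X) <= 0 by nra.
have : \sum_j ((col j X)^T *m col j X) 0 0 == 0.
  rewrite eq_le; apply/andP; split; first by under eq_bigr do rewrite nrm.
  by apply: sumr_ge0 => j _; rewrite mxE sumr_ge0// => k _; rewrite mxE -expr2 sqr_ge0.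
rewrite psumr_eq0; last first.
  by move=> j _; rewrite mxE sumr_ge0// => k _; rewrite mxE -expr2 sqr_ge0.
move=> /allP h; apply/matrixP => i j; rewrite mxE.
have /matrixP/(_ i 0) : col j X = 0; last by rewrite !mxE.
by apply: normsq_eq0; rewrite (eqP (h j (mem_index_enum j))).
Qed.

(** An injective endomorphism of a finite-dimensional space is onto. The solution is symmetric by
    uniqueness, because its transpose solves the same equation. *)
Lemma lyap_exists : exists X : 'M[R]_n.+1, X^T = X /\ A *m X + X *m A^T = - 1%:M.
Proof.
pose f : {linear 'M[R]_n.+1 -> 'M[R]_n.+1} := mulmx A \+ mulmxr A^T.
have fE X : f X = A *m X + X *m A^T by [].
have fu : lin_mx f \in unitmx.
  rewrite -row_free_unit -kermx_eq0; apply/eqP/row_matrixP => i; rewrite row0.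
  set u := row i _; have uA : u *m lin_mx f = 0 by apply/sub_kermxP; exact: row_sub.
  rewrite -[u]vec_mxK (lyap_inj (X := vec_mx u)) ?linear0//.
  by apply: (can_inj mxvecK); rewrite -fE -mul_vec_lin vec_mxK uA linear0.
pose X := vec_mx (mxvec (- 1%:M : 'M[R]_n.+1) *m invmx (lin_mx f)).
have AX : A *m X + X *m A^T = - 1%:M.
  by apply: (can_inj mxvecK); rewrite -fE -mul_vec_lin vec_mxK mulmxKV.
exists X; split => //; apply/eqP; rewrite -subr_eq0; apply/eqP/lyap_inj.
have AXT : A *m X^T + X^T *m A^T = - 1%:M.
  by have := congr1 trmx AX; rewrite linearD linearN/= !trmx_mul trmxK trmx1 addrC.
by rewrite mulmxBr mulmxBl addrACA -opprD AXT AX subrr.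
Qed.

End NegativeDefinite.

(** * Linear differential equations *)

Section LinearODE.
Context {R : realType}.

Lemma is_derive_sumf n (h : 'I_n -> R -> R) (dh : 'I_n -> R) (x : R) :
  (forall i, is_derive x 1 (h i) (dh i)) ->
  is_derive x 1 (fun t => \sum_i h i t) (\sum_i dh i).
Proof.
move=> hd; have -> : (fun t => \sum_i h i t) = \sum_i h i.
  by apply/funext => t; rewrite fct_sumE.
exact: is_derive_sum.
Qed.

Lemma is_derive_mulf (f g : R -> R) (df dg x : R) :
  is_derive x 1 f df -> is_derive x 1 g dg ->
  is_derive x 1 (fun t => f t * g t) (df * g x + f x * dg).
Proof.
move=> hf hg; have := is_deriveM hf hg.
by rewrite /GRing.scale/= addrC [g x * _]mulrC.
Qed.

Lemma is_derive_addf (f g : R -> R) (df dg x : R) :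
  is_derive x 1 f df -> is_derive x 1 g dg ->
  is_derive x 1 (fun t => f t + g t) (df + dg).
Proof. by move=> hf hg; exact: is_deriveD. Qed.

Lemma is_derive_oppf (f : R -> R) (df x : R) :
  is_derive x 1 f df -> is_derive x 1 (fun t => - f t) (- df).
Proof. by move=> hf; exact: is_deriveN. Qed.

Lemma is_derive_mulcf (f : R -> R) (c df x : R) :
  is_derive x 1 f df -> is_derive x 1 (fun t => c * f t) (c * df).
Proof. by move=> hf; exact: is_deriveZ. Qed.

Lemma is_derive_reverse (f : R -> R) (c df x : R) :
  is_derive (c - x) 1 f df -> is_derive x 1 (fun t => f (c - t)) (- df).
Proof.
move=> hf; have hg : is_derive x 1 (fun t : R => c - t) (- 1).
  have := is_derive_addf (is_derive_cst c x 1) (is_derive_oppf (is_derive_id x 1)).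
  by rewrite add0r.
by have := @is_derive1_comp _ f (fun t => c - t) x _ _ hf hg; rewrite mulrN mulr1.
Qed.

Variable n : nat.
Implicit Types (A : 'M[R]_n.+1) (v : 'rV[R]_n.+1).

Definition expv_coef A v j (k : nat) : R := (v *m A ^+ k) 0 j / k`!%:R.

Lemma norm1_mulmx A v : \sum_j `|(v *m A) 0 j| <= (\sum_j `|v 0 j|) * \sum_i \sum_j `|A i j|.
Proof.
apply: (@le_trans _ _ (\sum_j \sum_i `|v 0 i| * `|A i j|)).
  apply: ler_sum => j _; rewrite mxE (le_trans (ler_norm_sum _ _ _))//.
  by apply: ler_sum => i _; rewrite normrM.
rewrite exchange_big/= mulr_suml; apply: ler_sum => i _.
rewrite -mulr_sumr ler_wpM2l// [X in _ <= X](bigD1 i)//= lerDl.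
by apply: sumr_ge0 => k _; apply: sumr_ge0.
Qed.

Lemma expv_coef_bound A v j k :
  `|(v *m A ^+ k) 0 j| <= (\sum_j `|v 0 j|) * (\sum_i \sum_j `|A i j|) ^+ k.
Proof.
apply: (@le_trans _ _ (\sum_j `|(v *m A ^+ k) 0 j|)).
  by rewrite [X in _ <= X](bigD1 j)//= lerDl sumr_ge0.
elim: k => [|k IH]; first by rewrite expr0 mulmx1 expr0 mulr1.
rewrite !exprSr mulmxA mulrA (le_trans (norm1_mulmx _ _))// ler_wpM2r//.
by apply: sumr_ge0 => i _; apply: sumr_ge0.
Qed.

Lemma is_cvg_expv A v j (x : R) : cvgn (pseries (expv_coef A v j) x).
Proof.
apply: normed_cvg; rewrite /normed_series_of /=.
(* The entrywise 1-norm of [A]; the series is dominated by [V] times the exponential series at a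
   |x|. *)
pose a : R := \sum_i \sum_j `|A i j|; pose V : R := \sum_j `|v 0 j|.
have a0 : 0 <= a by apply: sumr_ge0 => i _; apply: sumr_ge0.
have V0 : 0 <= V by apply: sumr_ge0.
apply: (@series_le_cvg _ _ (fun k => V * exp_coeff (a * `|x|) k)).
- by move=> k /=.
- by move=> k; rewrite mulr_ge0// /exp_coeff/= divr_ge0// exprn_ge0// mulr_ge0.
- move=> k /=; rewrite /expv_coef /exp_coeff/= normrM normrM normrX normfV normr_nat.
  rewrite exprMn mulrAC !mulrA ler_wpM2r ?invr_ge0// ler_wpM2r ?exprn_ge0//.
  exact: expv_coef_bound.
- have h := @is_cvg_seriesZ _ _ V (is_cvg_series_exp_coeff (a * `|x|)).
  have e : (fun k => V * exp_coeff (a * `|x|) k) = V *: exp_coeff (a * `|x|).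
    by apply/funext => k.
  rewrite e; exact: h.
Qed.

(** The row vector v e^(A t), one real power series per coordinate, so that the scalar theory of
    power series applies. *)
Definition expv A v (t : R) : 'rV[R]_n.+1 :=
  \row_j limn (pseries (expv_coef A v j) t).

Lemma expv0 A v : expv A v 0 = v.
Proof.
apply/rowP => j; rewrite mxE; apply/cvg_lim => //.
(* The partial sum of index 0 is empty; from index 1 on, the partial sums are constant. *)
rewrite -cvg_shiftS /=.
have -> : (fun k => pseries (expv_coef A v j) 0 k.+1) = fun=> v 0 j; last exact: cvg_cst.
apply/funext => k; rewrite /pseries /series /= big_nat_recl//= big1 => [|i _].
  by rewrite expr0 /expv_coef expr0 mulmx1 fact0 invr1 !mulr1 addr0.
by rewrite exprS mul0r mulr0.
Qed.

Lemma expvM A v t : expv A (v *m A) t = expv A v t *m A.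
Proof.
apply/rowP => j; rewrite !mxE; apply/cvg_lim => //.
have -> : pseries (expv_coef A (v *m A) j) t =
    (fun k => \sum_i (pseries (expv_coef A v i) t k * A i j)).
  apply/funext => k; rewrite /pseries /series /=.
  under [RHS]eq_bigr do rewrite mulr_suml.
  rewrite exchange_big/=; apply: eq_bigr => l _.
  rewrite /expv_coef -mulmxA (_ : A *m A ^+ l = A ^+ l *m A); last first.
    by rewrite -[LHS]exprS exprSr.
  rewrite mulmxA mxE !mulr_suml; apply: eq_bigr => i _; ring.
apply: cvg_big => [|i _]; first exact: add_continuous.
by rewrite mxE; apply: cvgMr_tmp; exact: is_cvg_expv.
Qed.

Lemma is_derive_expv A v j (t : R) :
  is_derive t 1 (fun s => expv A v s 0 j) ((expv A v t *m A) 0 j).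
Proof.
(* The factor k + 1 from differentiation cancels against the factorial and leaves one more power of
   [A], moved onto the vector. *)
have dE w : pseries_diffs (expv_coef A w j) = expv_coef A (w *m A) j.
  apply/funext => k; rewrite /pseries_diffs /expv_coef factS natrM exprS mulmxA.
  by rewrite invfM [LHS]mulrCA mulVKf// mulrA [RHS]mulrC// pnatr_eq0.
rewrite -expvM mxE -dE.
have -> : (fun s => expv A v s 0 j) = (fun s => limn (pseries (expv_coef A v j) s)).
  by apply/funext => s; rewrite mxE.
(* The series converge everywhere; any radius larger than |t| would do. *)
apply: (@pseries_snd_diffs _ _ (`|t| + 1)); rewrite ?dE; try exact: is_cvg_expv.
by rewrite [X in _ < X]ger0_norm ?addr_ge0// ltrDl.
Qed.

Lemma is_derive_normsq A v (t : R) :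
  is_derive t 1 (fun s => (expv A v s *m (expv A v s)^T) 0 0)
    (2 * (expv A v t *m A *m (expv A v t)^T) 0 0).
Proof.
have -> : (fun s => (expv A v s *m (expv A v s)^T) 0 0) =
    fun s => \sum_j expv A v s 0 j * expv A v s 0 j.
  by apply/funext => s; rewrite mxE; apply: eq_bigr => j _; rewrite !mxE.
have -> : 2 * (expv A v t *m A *m (expv A v t)^T) 0 0 =
  \sum_j ((expv A v t *m A) 0 j * expv A v t 0 j + expv A v t 0 j * (expv A v t *m A) 0 j).
  rewrite mxE mulr_sumr; apply: eq_bigr => j _; rewrite [_^T _ _]mxE; ring.
by apply: is_derive_sumf => j; apply: is_derive_mulf; exact: is_derive_expv.
Qed.

(** Gronwall's argument: the squared norm times e^(2 mu s) has a nonpositive derivative. *)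
Lemma expv_decay A v (mu t : R) : 0 <= t ->
  (forall w : 'rV[R]_n.+1, (w *m A *m w^T) 0 0 <= - mu * (w *m w^T) 0 0) ->
  (expv A v t *m (expv A v t)^T) 0 0 <= (v *m v^T) 0 0 * expR (- (2 * mu * t)).
Proof.
move=> t0 hmu; pose E s := (expv A v s *m (expv A v s)^T) 0 0.
rewrite -/(E t) -ler_pdivrMr ?expR_gt0// -expRN opprK.
pose h s := E s * expR (2 * mu * s).
pose dh s := 2 * (expv A v s *m A *m (expv A v s)^T) 0 0 * expR (2 * mu * s) +
   E s * (expR (2 * mu * s) * (2 * mu)).
have hd (s : R) : is_derive s 1 h (dh s).
  apply: is_derive_mulf; first exact: is_derive_normsq.
  have := is_derive1_comp (is_derive_expR (2 * mu * s))
    (is_derive_mulcf (2 * mu) (is_derive_id s 1)).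
  by rewrite /GRing.scale/= !mulr1.
have hc : continuous h.
  by move=> s; apply: differentiable_continuous; apply/derivable1_diffP; case: (hd s).
have [c _ e] : exists2 c, c \in `[0, t]%R & h t - h 0 = dh c * (t - 0).
  by apply: MVT_segment => // s; exact: continuous_subspaceT.
have : h t - h 0 <= 0.
  rewrite e subr0 mulr_le0_ge0// /dh.
  have -> : 2 * (expv A v c *m A *m (expv A v c)^T) 0 0 * expR (2 * mu * c) +
    E c * (expR (2 * mu * c) * (2 * mu)) =
    2 * expR (2 * mu * c) * ((expv A v c *m A *m (expv A v c)^T) 0 0 - - mu * E c) by ring.
  by rewrite pmulr_rle0 ?mulr_gt0 ?expR_gt0// subr_le0; exact: hmu.
by rewrite subr_le0 /h /E mulr0 expR0 mulr1 expv0.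
Qed.

End LinearODE.

(** * Volterra equations *)

Section Volterra.
Context {R : realType}.
Local Notation mu := (@lebesgue_measure R).

Lemma primitive_continuous (f : R -> R) (b x : R) :
  mu.-integrable `[0, b] (EFin \o f) -> 0 < x -> x < b ->
  {for x, continuous (fun r : R => \int[mu]_(s in `[0, r]) f s)}.
Proof.
move=> fi x0 xb.
have b0 : 0 < b by exact: lt_trans xb.
have /(continuous_within_itvP _ b0)[h _ _] :=
  parameterized_integral_continuous (ltW b0) fi.
by apply: h; rewrite in_itv/= x0.
Qed.

Lemma is_derive_primitive (f : R -> R) (b x : R) :
  mu.-integrable `[0, b] (EFin \o f) -> 0 < x -> x < b ->
  {for x, continuous f} ->
  is_derive x 1 (fun r : R => \int[mu]_(s in `[0, r]) f s) (f x).
Proof.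
move=> fi x0 xb fc; have [d e] := continuous_FTC1_closed xb fi x0 fc.
by apply: DeriveDef => //; rewrite -derive1E.
Qed.

Lemma is_derive_continuous (f : R -> R) (df x : R) :
  is_derive x 1 f df -> {for x, continuous f}.
Proof. by move=> [d _]; apply: differentiable_continuous; exact/derivable1_diffP. Qed.

Lemma within_continuous_mulf (S : set R) (f g : R -> R) :
  {within S, continuous f} -> {within S, continuous g} ->
  {within S, continuous (fun x => f x * g x)}.
Proof. by move=> cf cg x; apply: cvgM; [exact: cf|exact: cg]. Qed.

Lemma within_continuous_addf (S : set R) (f g : R -> R) :
  {within S, continuous f} -> {within S, continuous g} ->
  {within S, continuous (fun x => f x + g x)}.
Proof. by move=> cf cg x; apply: cvgD; [exact: cf|exact: cg]. Qed.

Lemma within_continuous_sumf (S : set R) n (f : 'I_n -> R -> R) :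
  (forall i, {within S, continuous (f i)}) ->
  {within S, continuous (fun x => \sum_i f i x)}.
Proof.
move=> cf x; apply: cvg_big => [|i _]; first exact: add_continuous.
exact: cf.
Qed.

(* If [g] solves the Volterra equation [g = A int g + c] and [phi] the adjoint
   equation [phi' = - phi A], then [(phi g)' = phi c']. *)
Lemma volterra_pairing n (A : 'M[R]_n.+1) (g c c' : R -> 'cV[R]_n.+1)
    (phi : R -> 'rV[R]_n.+1) (W : R -> R) (a b : R) :
  0 <= a -> a <= b ->
  (forall i, mu.-integrable `[0, b] (EFin \o (fun s => g s i 0))) ->
  (forall r i, a <= r <= b ->
    g r i 0 = \sum_j A i j * (\int[mu]_(s in `[0, r]) g s j 0) + c r i 0) ->
  (forall i (t : R), is_derive t 1 (fun s => c s i 0) (c' t i 0)) ->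
  (forall j (t : R), is_derive t 1 (fun s => phi s 0 j) (- (phi t *m A) 0 j)) ->
  (forall t : R, is_derive t 1 W ((phi t *m c' t) 0 0)) ->
  (phi b *m g b) 0 0 - (phi a *m g a) 0 0 = W b - W a.
Proof.
move=> a0 ab gi gE dc dphi dW.
have [->|/eqP anb] := eqVneq a b; first by rewrite !subrr.
have {}ab : a < b by rewrite lt_neqAle ab andbT; exact/eqP.
pose G j r := \int[mu]_(s in `[0, r]) g s j 0.
pose e i r := \sum_j A i j * G j r + c r i 0.
pose h r := \sum_i phi r 0 i * e i r - W r.
have b0 : 0 <= b by apply: le_trans a0 (ltW ab).
have Gw j : {within `[a, b], continuous (G j)}.
  apply: (@continuous_subspaceW _ _ `[a, b] `[0, b]); last first.
    exact: parameterized_integral_continuous.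
  by apply: subset_itv; rewrite bnd_simp.
(* Bootstrapping: [g] is only integrable a priori, but it coincides on ]a, b[ with [e], which is
   continuous as a combination of primitives and of [c]. The fundamental theorem of calculus then
   applies to [g]. *)
have gG x j : a < x -> x < b -> is_derive x 1 (G j) (g x j 0).
  move=> ax xb; have x0 : 0 < x by exact: le_lt_trans ax.
  apply: (@is_derive_primitive _ b) => //.
  have ec : {for x, continuous (e j)}.
    apply: continuousD; last exact: is_derive_continuous (dc j x).
    have -> : (fun r => \sum_k A j k * G k r) = \sum_k (fun r => A j k * G k r).
      by apply/funext => r; rewrite fct_sumE.
    apply: (big_ind (fun f : R -> R => {for x, continuous f})).
    + exact: cst_continuous.
    + by move=> f1 f2 c1 c2; exact: continuousD.
    + move=> k _; apply: continuousM; first exact: cst_continuous.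
      exact: (@primitive_continuous _ b).
  have eg r : a < r < b -> e j r = g r j 0.
    by move=> /andP[ar rb]; rewrite gE// (ltW ar) (ltW rb).
  rewrite /prop_for /continuous_at -eg ?ax//; apply: cvg_trans ec.
  apply: near_eq_cvg; near=> r; apply: eg.
  have : r \in `]a, b[ by near: r; apply: near_in_itvoo; rewrite in_itv/= ax.
  by rewrite in_itv.
have hd (x : R) : x \in `]a, b[%R -> is_derive x 1 h 0.
  rewrite in_itv/= => /andP[ax xb].
  have := is_derive_addf (@is_derive_sumf _ _ (fun i r => phi r 0 i * e i r) _ x
    (fun i => is_derive_mulf (dphi i x) (is_derive_addf
      (@is_derive_sumf _ _ (fun j r => A i j * G j r) _ x
        (fun j => is_derive_mulcf (A i j) (gG x j ax xb))) (dc i x))))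
    (is_derive_oppf (dW x)).
  (* The term -phi A g from phi' cancels phi A g from the Volterra equation, and phi c' cancels the
     derivative of [W]. *)
  set D := (X in is_derive _ _ _ X); suff -> : D = 0 by [].
  rewrite /D.
  have eg i : \sum_j A i j * G j x + c x i 0 = g x i 0.
    by rewrite gE// (ltW ax) (ltW xb).
  under eq_bigr do rewrite eg mulrDr.
  have assoc : \sum_i (phi x *m A) 0 i * g x i 0 =
      \sum_i phi x 0 i * (\sum_j A i j * g x j 0).
    transitivity ((phi x *m A *m g x) 0 0); first by rewrite mxE.
    rewrite -mulmxA mxE; apply: eq_bigr => i _; congr (_ * _).
    by rewrite mxE.
  rewrite big_split/= big_split/= addrA -!addrA [X in _ + (_ - X)]mxE subrr addr0.
  by rewrite -assoc -big_split/= big1// => i _; rewrite mulNr addNr.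
have hw : {within `[a, b], continuous h}.
  apply: within_continuous_addf.
    apply: within_continuous_sumf => i; apply: within_continuous_mulf.
      by apply: continuous_subspaceT => r; exact: is_derive_continuous (dphi i r).
    apply: within_continuous_addf.
      apply: within_continuous_sumf => j; apply: within_continuous_mulf => //.
      by apply: continuous_subspaceT => r; exact: cst_continuous.
    by apply: continuous_subspaceT => r; exact: is_derive_continuous (dc i r).
  apply: continuous_subspaceT => r.
  exact: is_derive_continuous (is_derive_oppf (dW r)).
have [y _ hy] := MVT_segment (ltW ab) hd hw.
have hE r : a <= r <= b -> h r = (phi r *m g r) 0 0 - W r.
  move=> rab; rewrite mxE; congr (_ - _); apply: eq_bigr => i _.
  by rewrite (gE r i rab).
rewrite mul0r !hE ?lexx ?(ltW ab)// in hy.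
by apply/eqP; rewrite -subr_eq0; apply/eqP; rewrite -[RHS]hy; ring.
Unshelve. all: by end_near. Qed.

End Volterra.

(** * Square-integrable random variables *)

Section SecondOrder.
Context {R : realType}.

Lemma Lfun2P d (T : measurableType d) (m : {measure set T -> \bar R}) (f : T -> R) :
  measurable_fun setT f -> (\int[m]_x ((f x) ^+ 2)%:E < +oo)%E -> f \in Lfun m 2%:E.
Proof.
move=> mf fi; rewrite inE; apply/andP; split.
  exact: mem_set.
apply: mem_set.
rewrite /= /finite_norm unlock /Lnorm poweR_lty//.
by under eq_integral => x _/= do rewrite powR_mulrn// real_normK ?num_real//.
Qed.

Lemma Lfun2_lty d (T : measurableType d) (m : {measure set T -> \bar R}) (f : T -> R) :
  f \in Lfun m 2%:E -> (\int[m]_x ((f x) ^+ 2)%:E < +oo)%E.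
Proof. by move=> /Lfun2_integrable_sqr /integrable_lty; apply. Qed.

Lemma Lfun_measurable d (T : measurableType d) (m : {measure set T -> \bar R}) p (f : T -> R) :
  f \in Lfun m p -> measurable_fun setT f.
Proof. by rewrite inE => /andP[/set_mem]. Qed.

Section InnerProduct.
Context d (T : measurableType d) (P : probability T R).
Implicit Types Y Z : T -> R.

(** The L2 inner product as a real number; [ipE] shows that [fine] loses nothing on
    square-integrable variables. *)
Definition ip Y Z : R := fine ('E_P[(fun w => Y w * Z w)%R])%E.

Lemma ip_integrable Y Z : Y \in Lfun P 2%:E -> Z \in Lfun P 2%:E ->
  P.-integrable setT (fun w => (Y w * Z w)%:E).
Proof. by move=> hY hZ; exact/Lfun1_integrable/Lfun2_mul_Lfun1. Qed.

Lemma ipE Y Z : Y \in Lfun P 2%:E -> Z \in Lfun P 2%:E ->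
  ('E_P[(fun w => Y w * Z w)%R])%E = (ip Y Z)%:E.
Proof.
by move=> hY hZ; rewrite /ip fineK// expectation_fin_num//; exact: Lfun2_mul_Lfun1.
Qed.

Lemma ip_int Y Z : ip Y Z = \int[P]_w (Y w * Z w).
Proof. by rewrite /ip unlock. Qed.

Lemma ipC Y Z : ip Y Z = ip Z Y.
Proof. by rewrite !ip_int; apply: eq_Rintegral => w _; rewrite mulrC. Qed.

Lemma ipDl Y1 Y2 Z : Y1 \in Lfun P 2%:E -> Y2 \in Lfun P 2%:E -> Z \in Lfun P 2%:E ->
  ip (fun w => Y1 w + Y2 w) Z = ip Y1 Z + ip Y2 Z.
Proof.
move=> h1 h2 hZ; rewrite !ip_int -RintegralD//; try exact: ip_integrable.
by apply: eq_Rintegral => w _; rewrite mulrDl.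
Qed.

Lemma ipZl c Y Z : Y \in Lfun P 2%:E -> Z \in Lfun P 2%:E ->
  ip (fun w => c * Y w) Z = c * ip Y Z.
Proof.
move=> h1 hZ; rewrite !ip_int -RintegralZl//; first last.
- exact: ip_integrable.
by apply: eq_Rintegral => w _; rewrite mulrA.
Qed.

Lemma Lfun2D Y1 Y2 : Y1 \in Lfun P 2%:E -> Y2 \in Lfun P 2%:E ->
  (fun w => Y1 w + Y2 w) \in Lfun P 2%:E.
Proof.
move=> h1 h2; have p1 : (1 <= 2%:E :> \bar R)%E by rewrite lee_fin ler1n.
exact: (Lfun_addr_closed P p1).2.
Qed.

Lemma Lfun2Z c Y : Y \in Lfun P 2%:E -> (fun w => c * Y w) \in Lfun P 2%:E.
Proof.
move=> h; have := @Lfun_scale _ _ _ P Y c 2 _ h; rewrite ler1n => /(_ isT).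
by rewrite (_ : c \o* Y = fun w => c * Y w)//; apply/funext => w; rewrite /= mulrC.
Qed.

Lemma Lfun2_sum n (Y : 'I_n -> T -> R) : (forall i, Y i \in Lfun P 2%:E) ->
  (fun w => \sum_i Y i w) \in Lfun P 2%:E.
Proof.
move=> h; elim: n Y h => [|n IH] Y h.
  have -> : (fun w => \sum_(i < 0) Y i w) = cst 0 by apply/funext => w; rewrite big_ord0.
  exact: Lfun_cst.
have -> : (fun w => \sum_(i < n.+1) Y i w) =
   (fun w => Y ord0 w + \sum_(i < n) Y (lift ord0 i) w).
  by apply/funext => w; rewrite big_ord_recl.
by apply: Lfun2D => //; exact: IH.
Qed.

Lemma ip_suml n (Y : 'I_n -> T -> R) Z : (forall i, Y i \in Lfun P 2%:E) ->
  Z \in Lfun P 2%:E -> ip (fun w => \sum_i Y i w) Z = \sum_i ip (Y i) Z.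
Proof.
move=> h hZ; elim: n Y h => [|n IH] Y h.
  rewrite big_ord0 ip_int (@eq_Rintegral _ _ _ _ _ (cst 0)) ?Rintegral_cst ?mul0r//.
  by move=> w _; rewrite big_ord0 mul0r.
rewrite big_ord_recl -IH// -ipDl//; last exact: Lfun2_sum.
by rewrite /ip; congr (fine ('E_P[_])%E); apply/funext => w; rewrite big_ord_recl.
Qed.

Lemma ip_ae Y1 Y2 Z : Y1 \in Lfun P 2%:E -> Y2 \in Lfun P 2%:E -> Z \in Lfun P 2%:E ->
  {ae P, forall w, Y1 w = Y2 w} -> ip Y1 Z = ip Y2 Z.
Proof.
move=> h1 h2 hZ e; rewrite !ip_int; congr fine.
apply: ae_eq_integral => //.
- by have /integrableP[] := ip_integrable h1 hZ.
- by have /integrableP[] := ip_integrable h2 hZ.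
by apply: filterS e => w ->.
Qed.

Lemma Lfun2_ae Y1 Y2 : measurable_fun setT Y1 -> Y2 \in Lfun P 2%:E ->
  {ae P, forall w, Y1 w = Y2 w} -> Y1 \in Lfun P 2%:E.
Proof.
move=> m1 h2 e; apply: Lfun2P => //.
rewrite (_ : (\int[P]_x ((Y1 x) ^+ 2)%:E)%E = (\int[P]_x ((Y2 x) ^+ 2)%:E)%E).
  exact: Lfun2_lty.
apply: ge0_ae_eq_integral => //.
- by apply/measurable_EFinP; exact: measurable_funX.
- by apply/measurable_EFinP; apply: measurable_funX; exact: Lfun_measurable h2.
- by move=> w _; rewrite lee_fin sqr_ge0.
- by move=> w _; rewrite lee_fin sqr_ge0.
by apply: filterS e => w ->.
Qed.

End InnerProduct.
End SecondOrder.

(** * Time integrals of second-order processes *)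

Section ScalarProcess.
Context {R : realType} d (T : measurableType d) (P : probability T R).
Local Notation mu := (@lebesgue_measure R).
Variable y : R -> T -> R.
Hypothesis my : measurable_fun ((`[0, +oo[%classic : set R) `*` [set: T])
  (fun p : R * T => y p.1 p.2).
Hypothesis sqy : forall t : R, 0 <= t ->
  (\int[mu]_(s in `[0%R, t]) 'E_P[(fun w => (y s w) ^+ 2)%R] < +oo)%E.

Lemma process_measurable (t : R) : 0 <= t -> measurable_fun setT (y t).
Proof.
move=> t0; rewrite (_ : y t = (fun p : R * T => y p.1 p.2) \o pair t)//.
apply: (measurable_comp _ _ my); first exact: measurableX.
- by move=> p [w _ <-]; split => //=; rewrite in_itv/= t0.
- exact: pair1_measurable.
Qed.

(** The process extended by zero outside [0, t]: measurable on the whole product space, as Fubini's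
    theorem for [mu \x P] requires. *)
Definition stopped (t : R) (p : R * T) : R :=
  ((fun p : R * T => y p.1 p.2) \_ (`[0, t] `*` [set: T])) p.

Lemma stoppedE (t s : R) w : stopped t (s, w) = if s \in `[0, t] then y s w else 0.
Proof.
rewrite /stopped patchE; case: ifPn => [/set_mem[/= -> //]|]; case: ifPn => //.
by move=> st /negP; case; apply: mem_set; split.
Qed.

Lemma stopped_measurable t : measurable_fun setT (stopped t).
Proof.
have mD : measurable ((`[0, t]%classic : set R) `*` [set: T]) by exact: measurableX.
apply/(measurable_restrictT _ mD); apply: measurable_funS my; first exact: measurableX.
by move=> p [/=]; rewrite !in_itv/= => /andP[-> _].
Qed.

Lemma stopped_Lfun2 t : 0 <= t -> stopped t \in Lfun (mu \x P)%E 2%:E.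
Proof.
move=> t0; apply: Lfun2P; first exact: stopped_measurable.
rewrite fubini_tonelli1/=; first last.
- by move=> p; rewrite lee_fin sqr_ge0.
- by apply/measurable_EFinP/measurable_funX; exact: stopped_measurable.
apply: le_lt_trans (sqy t0); rewrite [leRHS]integral_mkcond le_eqVlt.
apply/orP; left; apply/eqP; apply: eq_integral => s _.
rewrite patchE /fubini_F mem_setE.
under eq_integral do rewrite stoppedE.
case: ifPn => // _; first by rewrite unlock.
by rewrite integral0_eq// => w _; rewrite expr0n.
Qed.

(** A nonzero [Z] alone is not square-integrable on the product, as Lebesgue measure is infinite;
    the indicator of [0, t] repairs this and disappears in products with [stopped t]. *)
Lemma clock_Lfun2 (Z : T -> R) (t : R) : 0 <= t -> Z \in Lfun P 2%:E ->
  (fun p : R * T => (\1_(`[0, t] : set R) p.1 : R) * Z p.2) \in Lfun (mu \x P)%E 2%:E.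
Proof.
move=> t0 hZ; have mZ : measurable_fun setT (fun p : R * T =>
    ((\1_(`[0, t] : set R) p.1 : R) * Z p.2)).
  apply: measurable_funM.
    by apply: measurableT_comp => //; exact: measurable_indic.
  by apply: measurableT_comp => //; exact: Lfun_measurable hZ.
apply: Lfun2P => //.
rewrite fubini_tonelli1/=; first last.
- by move=> p; rewrite lee_fin sqr_ge0.
- by apply/measurable_EFinP/measurable_funX.
rewrite (_ : (\int[mu]_x _)%E =
   (\int[mu]_(s in `[0%R, t]) (\int[P]_w ((Z w) ^+ 2)%:E))%E); last first.
  rewrite [RHS]integral_mkcond; apply: eq_integral => s _.
  rewrite patchE /fubini_F mem_setE /= indicE mem_setE.
  case: ifPn => _; first by under eq_integral do rewrite mul1r.
  by rewrite integral0_eq// => w _; rewrite mul0r expr0n.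
have [b bE] : exists b : R, (\int[P]_w ((Z w) ^+ 2)%:E)%E = b%:E.
  exists (fine (\int[P]_w ((Z w) ^+ 2)%:E)%E).
  by rewrite fineK// integrable_fin_num//; exact: Lfun2_integrable_sqr.
rewrite bE integral_cst//= lebesgue_measure_itv/= lte_fin.
by case: ifP => _; rewrite ?sube0 -EFinM ltry.
Qed.

(** Integrate (f - c)^2 >= 0 over [0, t], with c the mean value of f. *)
Lemma cauchy_schwarz_itv (f : R -> R) (t : R) : 0 <= t ->
  mu.-integrable `[0, t] (EFin \o f) ->
  mu.-integrable `[0, t] (EFin \o (fun s => f s ^+ 2)) ->
  (\int[mu]_(s in `[0, t]) f s) ^+ 2 <= t * \int[mu]_(s in `[0, t]) (f s ^+ 2).
Proof.
rewrite le_eqVlt => /predU1P[<- _ _|t0 fi f2i].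
  by rewrite set_itv1 !Rintegral_set1 expr0n mul0r.
set I := \int[mu]_(s in _) f s; set J := \int[mu]_(s in _) _ ^+ 2.
pose c := I / t.
have ci k : mu.-integrable `[0, t] (EFin \o (fun=> k : R)).
  apply/integrableP; split; first exact: measurable_cst.
  rewrite integral_cst//= lebesgue_measure_itv/= lte_fin t0 sube0.
  by rewrite -EFinM ltry.
have mt : \int[mu]_(s in `[0, t]) (c ^+ 2) = c ^+ 2 * t.
  by rewrite /Rintegral integral_cst//= lebesgue_measure_itv/= lte_fin t0 sube0.
have zi : mu.-integrable `[0, t] (EFin \o (fun s => 2 * c * f s)).
  have -> : EFin \o (fun s => 2 * c * f s) = (fun s => (2 * c)%:E * (EFin \o f) s)%E.
    by apply/funext => s.
  exact: integrableZl.
have si : mu.-integrable `[0, t] (EFin \o (fun s => f s ^+ 2 + c ^+ 2)).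
  have -> : EFin \o (fun s => f s ^+ 2 + c ^+ 2) =
    (fun s => (EFin \o (fun s => (f s ^+ 2)%R)) s + (EFin \o (fun=> (c ^+ 2)%R)) s)%E.
    by apply/funext => s.
  exact: integrableD.
have : \int[mu]_(s in `[0, t]) (2 * c * f s) <= \int[mu]_(s in `[0, t]) (f s ^+ 2 + c ^+ 2).
  by apply: le_Rintegral => // s _; have := sqr_ge0 (f s - c); nra.
rewrite RintegralD// RintegralZl// mt -/I -/J => h.
have cI : c * t = I by rewrite /c divfK ?gt_eqF.
by nra.
Qed.

Lemma stopped_ip_integrable (Z : T -> R) (t : R) : 0 <= t -> Z \in Lfun P 2%:E ->
  (mu \x P)%E.-integrable setT (fun p => (stopped t p * Z p.2)%:E).
Proof.
move=> t0 hZ.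
have /Lfun1_integrable := Lfun2_mul_Lfun1 (stopped_Lfun2 t0) (clock_Lfun2 t0 hZ).
apply: eq_integrable => // -[s w] _ /=; congr EFin.
rewrite stoppedE indicE mem_setE; case: ifPn => _; first by rewrite mul1r.
by rewrite !mul0r.
Qed.

Lemma stopped_integrable (t : R) : 0 <= t ->
  (mu \x P)%E.-integrable setT (fun p => (stopped t p)%:E).
Proof.
move=> t0; have := stopped_ip_integrable t0 (Lfun_cst P 1 2).
by apply: eq_integrable => // p _; rewrite mulr1.
Qed.

Definition time_integral (t : R) (w : T) : R := \int[mu]_(s in `[0, t]) y s w.

Lemma stopped_itv (t s : R) w : stopped t (s, w) = ((fun s => y s w) \_ `[0, t]) s.
Proof. by rewrite stoppedE patchE mem_setE. Qed.

Lemma time_integralE (t : R) w :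
  time_integral t w = fine (\int[mu]_s (stopped t (s, w))%:E)%E.
Proof.
rewrite /time_integral Rintegral_mkcond; congr fine.
by apply: eq_integral => s _; rewrite stopped_itv.
Qed.

Lemma time_integral_measurable (t : R) : 0 <= t -> measurable_fun setT (time_integral t).
Proof.
move=> t0; rewrite (_ : time_integral t = fine \o (fubini_G mu (fun p => (stopped t p)%:E))).
  by apply: measurableT_comp => //; exact: measurable_fubini_G (stopped_integrable t0).
by apply/funext => w; rewrite time_integralE.
Qed.

Lemma stopped_sqr_integrable (t : R) : 0 <= t ->
  (mu \x P)%E.-integrable setT (fun p => (stopped t p ^+ 2)%:E).
Proof. by move=> t0; exact: Lfun2_integrable_sqr (stopped_Lfun2 t0). Qed.

Lemma ae_integrable_path (t : R) : 0 <= t ->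
  {ae P, forall w, mu.-integrable `[0, t] (EFin \o (fun s => y s w))}.
Proof.
move=> t0; apply: filterS (ae_integrable2 (stopped_integrable t0)) => w h.
apply/(integrable_mkcond _ _).2 => //.
by apply: eq_integrable h => // s _; rewrite stopped_itv restrict_EFin.
Qed.

Lemma ae_sqr_integrable_path (t : R) : 0 <= t ->
  {ae P, forall w, mu.-integrable `[0, t] (EFin \o (fun s => y s w ^+ 2))}.
Proof.
move=> t0; apply: filterS (ae_integrable2 (stopped_sqr_integrable t0)) => w h.
apply/(integrable_mkcond _ _).2 => //.
apply: eq_integrable h => // s _; rewrite restrict_EFin stopped_itv /= !patchE.
by case: ifP => // _; rewrite expr0n.
Qed.

(** For almost every path, Cauchy-Schwarz bounds the squared integral by t times the integral of the
    square; Tonelli's theorem bounds the expectation of the latter. *)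
Lemma time_integral_Lfun2 (t : R) : 0 <= t -> time_integral t \in Lfun P 2%:E.
Proof.
move=> t0; apply: Lfun2P; first exact: time_integral_measurable.
pose J w := (\int[mu]_s (stopped t (s, w) ^+ 2)%:E)%E.
have mS : measurable_fun setT (fun p => (stopped t p ^+ 2)%:E).
  by apply/measurable_EFinP/measurable_funX; exact: stopped_measurable.
have S0 (p : R * T) : (0 <= (stopped t p ^+ 2)%:E)%E by rewrite lee_fin sqr_ge0.
have mJ : measurable_fun setT J by exact: (@measurable_fun_fubini_tonelli_G _ _ _ _ _ mu _ mS S0).
have Jfin : (\int[P]_w J w < +oo)%E.
  have := @fubini_tonelli2 _ _ _ _ _ mu P _ mS S0; rewrite /fubini_G -/J => <-.
  by have /integrable_lty := stopped_sqr_integrable t0; apply.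
apply: (@le_lt_trans _ _ (\int[P]_w (t%:E * J w))%E).
  apply: ae_ge0_le_integral => //.
  - by move=> w _; rewrite lee_fin sqr_ge0.
  - by apply/measurable_EFinP/measurable_funX; exact: time_integral_measurable.
  - by move=> w _; rewrite mule_ge0// integral_ge0.
  - exact: measurable_funeM.
  apply: filterS2 (ae_integrable_path t0) (ae_sqr_integrable_path t0) => w h1 h2 _.
  have JE : J w = (\int[mu]_(s in `[0%R, t]) (y s w ^+ 2))%:E.
    rewrite /Rintegral fineK; last exact: integrable_fin_num.
    rewrite integral_mkcond; apply: eq_integral => s _.
    rewrite restrict_EFin stopped_itv /= !patchE.
    by case: ifP => // _; rewrite expr0n.
  by rewrite JE -EFinM lee_fin; exact: cauchy_schwarz_itv.
by rewrite ge0_integralZl// ?lte_mul_pinfty// => w _; exact: integral_ge0.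
Qed.

Section InnerWith.
Hypothesis y2 : forall t : R, 0 <= t -> y t \in Lfun P 2%:E.
Variables (Z : T -> R) (t : R).
Hypotheses (t0 : 0 <= t) (hZ : Z \in Lfun P 2%:E).

Lemma stopped_section (s : R) :
  (\int[P]_w (stopped t (s, w) * Z w)%:E)%E =
  ((EFin \o (fun s => ip P (y s) Z)) \_ `[0, t]) s.
Proof.
rewrite patchE mem_setE; under eq_integral do rewrite stoppedE.
case: ifPn => st; last by rewrite integral0_eq// => w _; rewrite mul0r.
rewrite /= /ip unlock fineK//.
apply: integrable_fin_num => //; apply: ip_integrable => //; apply: y2.
by move: st; rewrite in_itv => /andP[].
Qed.

Lemma ip_path_integrable : mu.-integrable `[0, t] (EFin \o (fun s => ip P (y s) Z)).
Proof.
apply/(integrable_mkcond _ _).2 => //.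
apply: eq_integrable (integrable_fubini_F (stopped_ip_integrable t0 hZ)) => // s _.
by rewrite /fubini_F stopped_section.
Qed.

Lemma ip_time_integral :
  ip P (time_integral t) Z = \int[mu]_(s in `[0, t]) ip P (y s) Z.
Proof.
rewrite ip_int /Rintegral; congr fine.
rewrite [RHS]integral_mkcond.
transitivity (\int[mu]_s \int[P]_w (stopped t (s, w) * Z w)%:E)%E; last first.
  by apply: eq_integral => s _; exact: stopped_section.
rewrite (Fubini (stopped_ip_integrable t0 hZ)).
apply: ae_eq_integral => //.
- apply/measurable_EFinP/measurable_funM; first exact: time_integral_measurable.
  exact: Lfun_measurable hZ.
- exact: measurable_fubini_G (stopped_ip_integrable t0 hZ).
(* The constant factor [Z w] is pulled out of the time integral on integrable paths, that is, for
   almost every [w]. *)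
apply: filterS (ae_integrable2 (stopped_integrable t0)) => w h _.
transitivity (\int[mu]_s ((stopped t (s, w))%:E * (Z w)%:E))%E; last first.
  by apply: eq_integral => s _; rewrite EFinM.
rewrite integralZr//= EFinM time_integralE fineK//.
exact: integrable_fin_num.
Qed.

End InnerWith.
End ScalarProcess.

(** * Second moments of the state *)

Section QuadraticForms.
Context {R : realType}.

Lemma is_derive_quad n (X : 'M[R]_n) (phi : R -> 'rV[R]_n) (dphi : 'rV[R]_n) (t : R) :
  (forall j, is_derive t 1 (fun s => phi s 0 j) (dphi 0 j)) ->
  is_derive t 1 (fun s => (phi s *m X *m (phi s)^T) 0 0)
    ((dphi *m X *m (phi t)^T) 0 0 + (phi t *m X *m dphi^T) 0 0).
Proof.
move=> dp.
have E (a b : 'rV[R]_n) : (a *m X *m b^T) 0 0 = \sum_j (\sum_i X i j * a 0 i) * b 0 j.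
  rewrite mxE; apply: eq_bigr => j _; rewrite mxE [b^T _ _]mxE; congr (_ * _).
  by apply: eq_bigr => i _; rewrite mulrC.
have -> : (fun s => (phi s *m X *m (phi s)^T) 0 0) =
    fun s => \sum_j (\sum_i X i j * phi s 0 i) * phi s 0 j by apply/funext => s.
rewrite !E -big_split/=; apply: is_derive_sumf => j; apply: is_derive_mulf => //.
by apply: is_derive_sumf => i; exact: is_derive_mulcf.
Qed.

(** A crude bound from 2 |u_i| |u_j| <= u_i^2 + u_j^2, sufficient to carry the decay of [expv] over
    to quadratic forms. *)
Lemma quad_le n (X : 'M[R]_n) (u : 'rV[R]_n) :
  `|(u *m X *m u^T) 0 0| <= (\sum_i \sum_j `|X i j|) * (u *m u^T) 0 0.
Proof.
have uE : (u *m u^T) 0 0 = \sum_i u 0 i ^+ 2.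
  by rewrite mxE; apply: eq_bigr => i _; rewrite mxE.
have ui i : u 0 i ^+ 2 <= (u *m u^T) 0 0.
  rewrite uE (bigD1 i)//= lerDl; apply: sumr_ge0 => j _; exact: sqr_ge0.
rewrite mxE (le_trans (ler_norm_sum _ _ _))// exchange_big mulr_suml.
apply: ler_sum => j _; rewrite [u^T _ _]mxE normrM mxE.
rewrite mulr_suml; apply: (@le_trans _ _ ((\sum_i `|u 0 i| * `|X i j|) * `|u 0 j|)).
  rewrite ler_wpM2r// (le_trans (ler_norm_sum _ _ _))//.
  by apply: ler_sum => i _; rewrite normrM.
rewrite mulr_suml; apply: ler_sum => i _.
rewrite mulrAC mulrC ler_wpM2l//.
have := ui i; have := ui j; rewrite -(real_normK (num_real (u 0 i))).
rewrite -(real_normK (num_real (u 0 j))); have := sqr_ge0 (`|u 0 i| - `|u 0 j|).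
by nra.
Qed.

End QuadraticForms.

Section StateMoments.
Context {R : realType} (n : nat) d (T : measurableType d) (P : probability T R).
Local Notation mu := (@lebesgue_measure R).
Variables (A : 'M[R]_n.+1) (xi : 'I_n.+1 -> (R -> R) -> T -> R).
Variable x : R -> T -> 'cV[R]_n.+1.
Hypotheses (hxi : white_noise P xi) (hx : lti_solution P A xi x).

Definition state (i : 'I_n.+1) (t : R) (w : T) : R := x t w i ord0.
(** The i-th noise integrated over [0, t]. Its covariance, computed in [noise_cov], is that of
    Brownian motion. *)
Definition noise (i : 'I_n.+1) (t : R) : T -> R := xi i \1_(`[0, t]).

Lemma half_line_L2_indic (t : R) : half_line_L2 (\1_(`[0, t]) : R -> R).
Proof.
split; first exact: measurable_indic.
apply: (@le_lt_trans _ _ (\int[mu]_(s in `[0%R, +oo[) (\1_(`[0, t]) s)%:E)%E).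
  rewrite le_eqVlt; apply/orP; left; apply/eqP; apply: eq_integral => s _.
  by rewrite indicE; case: (_ \in _); rewrite ?expr1n// expr0n.
rewrite integral_indic//= (le_lt_trans (le_measure _ _ _ (@subIsetl _ _ _)))//.
- by apply: mem_set; exact: measurableI.
- exact: mem_set.
have : (mu (`[0%R, t]%classic : set R) < +oo)%E; last by [].
by rewrite lebesgue_measure_itv/=; case: ifP => // _; rewrite -EFinD ltry.
Qed.

Lemma noise_Lfun2 i t : noise i t \in Lfun P 2%:E.
Proof. by case: hxi => h _ _; apply: h; exact: half_line_L2_indic. Qed.

Lemma noise_cov i j (s t : R) : 0 <= s -> 0 <= t ->
  ip P (noise i s) (noise j t) = (i == j)%:R * Num.min s t.
Proof.
move=> s0 t0; case: hxi => _ _ /(_ i j _ _ (half_line_L2_indic s) (half_line_L2_indic t)).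
rewrite /ip => -> /=; congr (_ * _).
have -> : \int[mu]_(r in `[0, +oo[) ((\1_(`[0, s]) r : R) * \1_(`[0, t]) r) =
    \int[mu]_(r in `[0, +oo[) (\1_(`[0, Num.min s t]) r : R).
  apply: eq_Rintegral => r _; rewrite !indicE !mem_setE !in_itv/= le_min.
  by rewrite -natrM mulnb; case: (0 <= r).
rewrite /Rintegral integral_indic//=.
have -> : (`[0, Num.min s t] `&` `[0, +oo[)%classic = `[0, Num.min s t]%classic :> set R.
  by apply/setIidl => r /=; rewrite !in_itv/= => /andP[->].
have -> : fine (mu (`[0%R, Num.min s t]%classic : set R)) = Num.min s t; last by [].
rewrite lebesgue_measure_itv/= lte_fin; case: ltP => [_|]; first by rewrite sube0.
by move=> h; apply/esym/le_anti; rewrite h le_min s0 t0.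
Qed.

Lemma state_eq i (t : R) : 0 <= t ->
  {ae P, forall w, state i t w =
    \sum_j A i j * time_integral (state j) t w + noise i t w}.
Proof.
move=> t0; case: hx => _ _ _ /(_ t t0); apply: filterS => w e.
by rewrite /state e !mxE; congr (_ + _); apply: eq_bigr => j _; rewrite mxE.
Qed.

Let my j := (let: And4 h _ _ _ := hx in h) j.
Let sqy j := (let: And4 _ h _ _ := hx in h) j.

(** The definition of a solution bounds second moments only after integration in time. The state
    equation upgrades this to every t >= 0, its right-hand side being square-integrable. *)
Lemma state_Lfun2 i (t : R) : 0 <= t -> state i t \in Lfun P 2%:E.
Proof.
move=> t0; apply: (Lfun2_ae _ _ (state_eq i t0)).
  exact: (@process_measurable _ _ _ (state i) (my i)).
apply: Lfun2D; last exact: noise_Lfun2.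
apply: Lfun2_sum => j; apply: Lfun2Z.
exact: (@time_integral_Lfun2 _ _ _ _ (state j) (my j) (sqy j)).
Qed.

(** Pairing the state equation with a fixed [Z] leaves a deterministic Volterra equation. *)
Lemma moment_eq i Z (t : R) : 0 <= t -> Z \in Lfun P 2%:E ->
  ip P (state i t) Z =
  \sum_j A i j * (\int[mu]_(s in `[0, t]) ip P (state j s) Z) + ip P (noise i t) Z.
Proof.
move=> t0 hZ.
have hI j : time_integral (state j) t \in Lfun P 2%:E.
  exact: (@time_integral_Lfun2 _ _ _ _ (state j) (my j) (sqy j)).
have hS : (fun w => \sum_j A i j * time_integral (state j) t w) \in Lfun P 2%:E.
  by apply: Lfun2_sum => j; exact: Lfun2Z.
have hN := noise_Lfun2 i t.
rewrite (ip_ae (state_Lfun2 i t0) (Lfun2D hS hN) hZ (state_eq i t0)) ipDl//.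
congr (_ + _); rewrite ip_suml//; last by move=> j; exact: Lfun2Z.
apply: eq_bigr => j _; rewrite ipZl//; congr (_ * _).
apply: (@ip_time_integral _ _ _ _ (state j) (my j) (sqy j)) => // s s0.
exact: state_Lfun2.
Qed.

Lemma state_ip_integrable i Z (t : R) : 0 <= t -> Z \in Lfun P 2%:E ->
  mu.-integrable `[0, t] (EFin \o (fun s => ip P (state i s) Z)).
Proof.
move=> t0 hZ.
apply: (@ip_path_integrable _ _ _ _ (state i) (my i) (sqy i)) => // s s0.
exact: state_Lfun2.
Qed.

Section Functional.
Variables (v : 'rV[R]_n.+1) (t1 : R).
Hypotheses (t10 : 0 <= t1) (Au : A \in unitmx).

Definition output (w : T) : R := \sum_i v 0 i * state i t1 w.

Lemma output_Lfun2 : output \in Lfun P 2%:E.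
Proof. by apply: Lfun2_sum => i; apply: Lfun2Z; exact: state_Lfun2. Qed.

Let phi (s : R) := expv A v (t1 - s).
(** An antiderivative of [phi]: since phi' = -phi A, the derivative of -phi A^-1 is phi. *)
Let Phi (s : R) := - (phi s *m invmx A).

Let dphi j (s : R) : is_derive s 1 (fun s => phi s 0 j) (- (phi s *m A) 0 j).
Proof. exact: (is_derive_reverse (is_derive_expv A v j (t1 - s))). Qed.

Let dPhi k (s : R) : is_derive s 1 (fun s => Phi s 0 k) (phi s 0 k).
Proof.
have -> : (fun s => Phi s 0 k) = fun s => - \sum_j invmx A j k * phi s 0 j.
  apply/funext => r; rewrite /Phi !mxE; congr (- _).
  by apply: eq_bigr => j _; rewrite mulrC.
have -> : phi s 0 k = - \sum_j invmx A j k * (- (phi s *m A) 0 j).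
  rewrite -sumrN -{1}(mulmxK Au (phi s)) mxE.
  by apply: eq_bigr => j _; rewrite mulrN opprK mulrC.
apply: is_derive_oppf; apply: is_derive_sumf => j; exact: is_derive_mulcf.
Qed.

Let phi_end : phi t1 = v.
Proof. by rewrite /phi subrr expv0. Qed.

Let ip_output Z : Z \in Lfun P 2%:E ->
  ip P output Z = (phi t1 *m \col_i ip P (state i t1) Z) 0 0.
Proof.
move=> hZ; rewrite phi_end mxE /output ip_suml//; last first.
  by move=> i; apply: Lfun2Z; exact: state_Lfun2.
by apply: eq_bigr => i _; rewrite ipZl ?mxE//; exact: state_Lfun2.
Qed.

(** The Volterra equation is driven by min(r, s) in coordinate k, which has slope 1 up to s and is
    constant afterwards. The pairing therefore grows by the integral of phi_k over [0, s] and is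
    constant on [s, t1]. *)
Lemma output_noise_cov k (s : R) : 0 <= s -> s <= t1 ->
  ip P output (noise k s) = Phi s 0 k - Phi 0 0 k.
Proof.
move=> s0 st; have hN := noise_Lfun2 k s.
pose g r := \col_i ip P (state i r) (noise k s).
have gi b i : 0 <= b -> mu.-integrable `[0, b] (EFin \o (fun r => g r i 0)).
  move=> b0; apply: eq_integrable (state_ip_integrable i b0 hN) => // r _.
  by rewrite /= mxE.
have gE r i : 0 <= r -> g r i 0 =
    \sum_j A i j * (\int[mu]_(s in `[0, r]) g s j 0) + (i == k)%:R * Num.min r s.
  move=> r0; rewrite mxE moment_eq// noise_cov//; congr (_ + _).
  apply: eq_bigr => j _; congr (_ * _); apply: eq_Rintegral => q _.
  by rewrite mxE.
have g0 : g 0 = 0.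
  apply/colP => i; rewrite gE// mxE big1 ?add0r => [|j _].
    by rewrite (min_idPl s0) mulr0.
  by rewrite set_itv1 Rintegral_set1 mulr0.
(* On [0, s] the forcing min(r, s) is replaced by r, which is differentiable everywhere. *)
have p1 : (phi s *m g s) 0 0 - (phi 0 *m g 0) 0 0 = Phi s 0 k - Phi 0 0 k.
  apply: (@volterra_pairing R n A g (fun r => \col_i ((i == k)%:R * r))
    (fun r => \col_i (i == k)%:R) phi (fun r => Phi r 0 k)) => //.
  - by move=> i; exact: gi.
  - by move=> r i /andP[r0 rs]; rewrite gE// mxE (min_idPl rs).
  - move=> i r; rewrite mxE.
    have -> : (fun r : R => (\col_i0 ((i0 == k)%:R * r)) i 0) = fun r => (i == k)%:R * r.
      by apply/funext => q; rewrite mxE.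
    have := is_derive_mulcf (i == k)%:R (is_derive_id r (1 : R)).
    by rewrite mulr1.
  - move=> r; suff -> : (phi r *m \col_i (i == k)%:R) 0 0 = phi r 0 k by exact: dPhi.
    rewrite mxE (bigD1 k)//= mxE eqxx mulr1 big1 ?addr0// => i /negbTE ik.
    by rewrite mxE ik mulr0.
(* On [s, t1] the forcing is the constant s, with zero derivative. *)
have p2 : (phi t1 *m g t1) 0 0 - (phi s *m g s) 0 0 = 0 - 0 :> R.
  apply: (@volterra_pairing R n A g (fun r => \col_i ((i == k)%:R * s))
    (fun r => 0) phi (fun r => 0)) => //.
  - by move=> i; exact: gi.
  - move=> r i /andP[sr _]; rewrite gE ?(le_trans s0)// mxE.
    by rewrite (min_idPr sr).
  - by move=> i r; rewrite !mxE; exact: is_derive_cst.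
  - by move=> r; rewrite mulmx0 mxE; exact: is_derive_cst.
rewrite ip_output//; move: p1 p2; rewrite g0 mulmx0 [X in _ - X]mxE !subr0.
by move=> <- /eqP; rewrite subr_eq0 => /eqP.
Qed.

(** The output is now paired with itself: by [output_noise_cov] the forcing has derivative phi^T,
    and by the Lyapunov equation phi phi^T is the derivative of phi X phi^T. *)
Lemma output_second_moment (X : 'M[R]_n.+1) : A *m X + X *m A^T = - 1%:M ->
  ip P output output =
  (v *m X *m v^T) 0 0 - (expv A v t1 *m X *m (expv A v t1)^T) 0 0.
Proof.
move=> AX; have hN := output_Lfun2.
pose g r := \col_i ip P (state i r) output.
have gi b i : 0 <= b -> mu.-integrable `[0, b] (EFin \o (fun r => g r i 0)).
  move=> b0; apply: eq_integrable (state_ip_integrable i b0 hN) => // r _.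
  by rewrite /= mxE.
have gE r i : 0 <= r -> r <= t1 -> g r i 0 =
    \sum_j A i j * (\int[mu]_(s in `[0, r]) g s j 0) + (Phi r 0 i - Phi 0 0 i).
  move=> r0 rt; rewrite mxE moment_eq// (ipC _ (noise i r)) output_noise_cov//.
  congr (_ + _); apply: eq_bigr => j _; congr (_ * _); apply: eq_Rintegral => q _.
  by rewrite mxE.
have g0 : g 0 = 0.
  apply/colP => i; rewrite gE// subrr addr0 mxE big1// => j _.
  by rewrite set_itv1 Rintegral_set1 mulr0.
have p1 : (phi t1 *m g t1) 0 0 - (phi 0 *m g 0) 0 0 =
    (phi t1 *m X *m (phi t1)^T) 0 0 - (phi 0 *m X *m (phi 0)^T) 0 0.
  apply: (@volterra_pairing R n A g (fun r => \col_i (Phi r 0 i - Phi 0 0 i))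
    (fun r => (phi r)^T) phi (fun r => (phi r *m X *m (phi r)^T) 0 0)) => //.
  - by move=> i; exact: gi.
  - by move=> r i /andP[r0 rs]; rewrite gE// [in RHS]mxE.
  - move=> i r; rewrite mxE.
    have -> : (fun r => (\col_i0 (Phi r 0 i0 - Phi 0 0 i0)) i 0) =
        fun r => Phi r 0 i + cst (- Phi 0 0 i) r.
      by apply/funext => q; rewrite mxE.
    by have := is_derive_addf (dPhi i r) (is_derive_cst (- Phi 0 0 i) r 1); rewrite addr0.
  - move=> r.
    have dp j : is_derive r 1 (fun s => phi s 0 j) ((- (phi r *m A)) 0 j).
      by rewrite mxE; exact: dphi.
    have := is_derive_quad X dp.
    suff -> : (- (phi r *m A) *m X *m (phi r)^T) 0 0 +
      (phi r *m X *m (- (phi r *m A))^T) 0 0 = (phi r *m (phi r)^T) 0 0 by [].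
    have -> : (phi r *m (phi r)^T) 0 0 = (- (phi r *m (A *m X + X *m A^T) *m (phi r)^T)) 0 0.
      by rewrite AX mulmxN mulmx1 mulNmx opprK.
    rewrite mulmxDr mulmxDl linearN/= trmx_mul !mulNmx mulmxN opprD !mulmxA.
    by rewrite [RHS]mxE.
rewrite ip_output// -/(g t1); move: p1; rewrite g0 mulmx0 [X in _ - X]mxE subr0 => ->.
by rewrite phi_end /phi subr0.
Qed.

End Functional.
End StateMoments.

(** * Limit of the mean cost *)

Section MeanCost.
Context {R : realType} (n m : nat) d (T : measurableType d) (P : probability T R).
Variables (A : 'M[R]_n.+1) (C : 'M[R]_(m, n.+1)) (xi : 'I_n.+1 -> (R -> R) -> T -> R).
Variable x : R -> T -> 'cV[R]_n.+1.
Hypotheses (hxi : white_noise P xi) (hx : lti_solution P A xi x).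

(** The cost is the sum of the squares of the coordinates of C x, and each row of [C] is an instance
    of the vector [v] of [output_second_moment]. *)
Lemma mean_costE (X : 'M[R]_n.+1) (t : R) : A \in unitmx ->
  A *m X + X *m A^T = - 1%:M -> 0 <= t ->
  mean_cost P (C^T *m C) x t =
  (\tr (X *m (C^T *m C)) -
    \sum_k (expv A (row k C) t *m X *m (expv A (row k C) t)^T) 0 0)%:E.
Proof.
move=> Au AX t0.
pose Y k := output x (row k C) t.
have hY k : Y k \in Lfun P 2%:E by exact: (output_Lfun2 hxi hx).
have YE k w : Y k w = (C *m x t w) k 0.
  by rewrite /Y /output mxE; apply: eq_bigr => i _; rewrite mxE.
rewrite /mean_cost (_ : (fun w => _) = fun w => \sum_k Y k w * Y k w); last first.
  apply/funext => w; rewrite mulmxA -trmx_mul -mulmxA mxE; apply: eq_bigr => k _.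
  by rewrite mxE YE.
rewrite unlock.
under eq_integral do rewrite -sumEFin.
rewrite integral_sum//; last by move=> k; exact: ip_integrable.
have -> : \tr (X *m (C^T *m C)) = \sum_k (row k C *m X *m (row k C)^T) 0 0.
  rewrite mulmxA mxtrace_mulC mulmxA; apply: eq_bigr => k _.
  by rewrite tr_row -row_mul mxE [RHS]mxE; apply: eq_bigr => j _; rewrite !mxE.
rewrite -sumrB -sumEFin; apply: eq_bigr => k _.
have /= <- := output_second_moment hxi hx (row k C) t0 Au AX.
by rewrite -(ipE (hY k) (hY k)) unlock.
Qed.

Lemma cvg_quad_expv (X : 'M[R]_n.+1) (v : 'rV[R]_n.+1) (c : R) : 0 < c ->
  (forall w : 'rV[R]_n.+1, (w *m A *m w^T) 0 0 <= - c * (w *m w^T) 0 0) ->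
  (expv A v t *m X *m (expv A v t)^T) 0 0 @[t --> +oo] --> 0.
Proof.
move=> c0 hc; pose K := (\sum_i \sum_j `|X i j|) * (v *m v^T) 0 0.
have h : K * expR (- (2 * c * t)) @[t --> +oo] --> 0.
  rewrite -[X in _ --> X](mulr0 K); apply: cvgMl_tmp.
  have e2 : 2 * c * t @[t --> +oo] --> +oo.
    by apply: gt0_cvgMry; [exact: mulr_gt0|exact: cvg_id].
  exact: (cvg_comp _ _ e2 (@cvgr_expR R)).
have hn : - (K * expR (- (2 * c * t))) @[t --> +oo] --> 0.
  by rewrite -oppr0; exact: cvgN.
apply: (squeeze_cvgr _ hn h).
near=> t; rewrite -ler_norml.
have t0 : 0 <= t by near: t; exact: nbhs_pinfty_ge.
rewrite (le_trans (quad_le _ _))// /K -mulrA ler_wpM2l//.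
  by apply: sumr_ge0 => i _; apply: sumr_ge0.
exact: expv_decay.
Unshelve. all: by end_near. Qed.

Lemma mean_cost_cvg (X : 'M[R]_n.+1) : (forall j, symeig (sympart A) j < 0) ->
  A *m X + X *m A^T = - 1%:M ->
  mean_cost P (C^T *m C) x t @[t --> +oo] --> (\tr (X *m (C^T *m C)))%:E.
Proof.
move=> hAs AX; have Au := negdef_unit hAs.
have [c c0 hc] := sympart_negdef hAs.
have hc' (w : 'rV[R]_n.+1) : (w *m A *m w^T) 0 0 <= - c * (w *m w^T) 0 0.
  by have := hc w^T; rewrite trmxK.
pose f t := \tr (X *m (C^T *m C)) -
    \sum_k (expv A (row k C) t *m X *m (expv A (row k C) t)^T) 0 0.
have hf : f t @[t --> +oo] --> \tr (X *m (C^T *m C)).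
  rewrite -[X in _ --> X]subr0; apply: cvgB; first exact: cvg_cst.
  rewrite [X in _ --> X](_ : 0 = \sum_(k < m) 0 :> R); last by rewrite big1.
  apply: cvg_big => [|k _]; first exact: add_continuous.
  exact: (cvg_quad_expv _ _ c0).
(* The formula is available for t >= 0 only, which is enough near +oo. *)
have E : \forall t \near +oo, mean_cost P (C^T *m C) x t = (f t)%:E.
  apply: filterS (nbhs_pinfty_ge (num_real (0 : R))) => t t0.
  exact: mean_costE.
apply: cvg_EFin; first by apply: filterS E => t ->.
apply: cvg_trans hf; apply: near_eq_cvg.
by apply: filterS E => t /= ->.
Qed.

End MeanCost.

Unset Implicit Arguments.

Theorem theorem1 (R : realType) (n m : nat)
    (A : 'M[R]_n.+1) (C : 'M[R]_(m, n.+1))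
    (d : measure_display) (T : measurableType d) (P : probability T R)
    (xi : 'I_n.+1 -> (R -> R) -> T -> R) (x : R -> T -> 'cV[R]_n.+1)
    (hA : hurwitz A) (hAs : hurwitz (sympart A))
    (hxi : white_noise P xi) (hx : lti_solution P A xi x) :
  let Q := C^T *m C in
  let lower := - \sum_(i < n.+1) lambda_min Q / (2 * complex.Re (eig A i)) in
  let upper := - \sum_(i < n.+1) symeig Q i / (2 * symeig (sympart A) i) in
  [/\ cvg (mean_cost P Q x t @[t --> +oo]),
      (lower%:E <= rho_ss P Q x <= upper%:E)%E
    & Q <> 0 ->
      (lower%:E = rho_ss P Q x <->
       A^T *m A = A *m A^T /\ (forall i j, symeig Q i = symeig Q j))].
Proof.
move=> Q lower upper.
have hs := symeig_hurwitz hAs.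
have [X [Xsym AX]] := lyap_exists hs.
(* From here on [rho_ss] is the trace of [X *m Q], and the remaining claims are purely algebraic. *)
have cvgQ := mean_cost_cvg hxi hx hs AX (C := C).
have rhoE : rho_ss P Q x = (\tr (X *m Q))%:E by apply/cvg_lim => //; exact: cvgQ.
have [|bounds equality] := lyap_bounds Xsym AX hs _ (symeig_gram_ge0 C).
  by rewrite trmx_mul trmxK.
rewrite rhoE !lee_fin; split => //; first by apply/cvg_ex; eexists; exact: cvgQ.
move=> /equality [h1 h2]; split => [e|/h2 e]; last exact: congr1 e.
by apply: h1; exact: EFin_inj e.
Qed.
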